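(* Let $V,W$ be pointwise finite dimensional (PFD) persistence modules, let $\phi\colon V\to W$ be a persistence module morphism, and let $\sigma\colon\mathbb{R}\to\mathbb{R}$ be a translation map. Let $\mathcal{X}_\phi\colon \mathbf{PD}(V)\nrightarrow\mathbf{PD}(W)$ be the matching induced by $\phi$, and suppose that $\mathcal{X}_\phi([b,d,i])=[b',d',i']$. (i) If $\operatorname{coker}\phi$ is $\sigma$-trivial, then $\langle b,d\rangle$ bounds $\sigma(\langle b',d'\rangle)$ below, i.e. $\langle b,d\rangle\lhd\sigma(\langle b',d'\rangle)$, and $\operatorname{im}\mathcal{X}_\phi$ contains all $\sigma$-nontrivial points of $\mathbf{PD}(W)$. (ii) If $\ker\phi$ is $\sigma$-trivial, then $\langle b',d'\rangle$ bounds $\sigma^{-1}(\langle b,d\rangle)$ above, i.e. $\sigma^{-1}(\langle b,d\rangle)\blacktriangleleft\langle b',d'\rangle$, and $\operatorname{dom}\mathcal{X}_\phi$ contains all $\sigma$-nontrivial points of $\mathbf{PD}(V)$.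
   Context: Fix a field $\mathsf{k}$. A persistence module $V=(V,\varphi_V)$ is a family of $\mathsf{k}$-vector spaces $\{V_t\}_{t\in\mathbb{R}}$ with linear maps $\varphi_V(s,t)\colon V_s\to V_t$ for $s\le t$ such that $\varphi_V(t,t)=\mathrm{id}$ and $\varphi_V(s,t)\circ\varphi_V(r,s)=\varphi_V(r,t)$ for $r\le s\le t$. It is PFD if every $V_t$ is finite-dimensional. A morphism $\phi\colon V\to W$ is a family of linear maps $\phi_t\colon V_t\to W_t$ with $\phi_t\circ\varphi_V(s,t)=\varphi_W(s,t)\circ\phi_s$ for $s\le t$; it is a monomorphism (epimorphism) if every $\phi_t$ is injective (surjective). Kernels, images, cokernels are taken pointwise. Translation map: a monotone (non-decreasing) function $\sigma\colon\mathbb{R}\to\mathbb{R}$ with $x\le\sigma(x)$ for all $x$. A persistence module $V$ is $\sigma$-trivial if $\varphi_V(t,\sigma(t))=0$ for all $t\in\mathbb{R}$. Decorated points: $\mathbb{E}=\mathbb{R}\times\{-,+\}\cup\{-\infty,\infty\}$, with $t^\pm=(t,\pm)$, totally ordered lexicographically with $-<+$, and with minimum $-\infty$ and maximum $\infty$. A nonempty interval $J\subseteq\mathbb{R}$ with endpoints $a\le b$ in $\overline{\mathbb{R}}$ is represented by $(\mathcal{B}(J),\mathcal{D}(J))\in\mathbb{E}^2$, where $\mathcal{B}(J)=-\infty$ if $a=-\infty$, $a^-$ if $J$ is left closed, $a^+$ if $J$ is left open; and $\mathcal{D}(J)=\infty$ if $b=\infty$, $b^-$ if $J$ is right open, $b^+$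 if $J$ is right closed. For $d_1<d_2$ in $\mathbb{E}$, $\langle d_1,d_2\rangle$ denotes the interval represented by $(d_1,d_2)$. The interval module $I_J$ is $\mathsf{k}$ at $t\in J$ and $0$ otherwise, with identity maps between points of $J$ and zero maps otherwise. Every PFD persistence module $V$ is a direct sum of interval modules, uniquely up to reindexing; the (decorated) persistence diagram $\mathbf{PD}(V)\subset\mathbb{E}\times\mathbb{E}\times\mathbb{N}$ consists of the points $[\mathcal{B}(J),\mathcal{D}(J),k]$, $k=1,\dots,m(I_J)$, for each interval $J$ occurring in the decomposition with multiplicity $m(I_J)$. A matching $\mathcal{X}\colon S\nrightarrow T$ is a relation that is the graph of an injective function $S'\to T'$ with $S'\subseteq S$, $T'\subseteq T$; $\operatorname{dom}$ and $\operatorname{im}$ are those of this function, and $\mathcal{X}(s)=t$ means $(s,t)\in\mathcal{X}$. Induced matchings: for $b,d\in\mathbb{E}$ let $\mathbf{PD}_b(V)$ be the set of points of $\mathbf{PD}(V)$ with first coordinate $b$, ordered by decreasing second coordinate and then increasing index (left-handed ordering); let $\mathbf{PD}^d(V)$ be the set of points with second coordinate $d$, ordered by increasing first coordinate and then increasing index (right-handed ordering). If there is a monomorphism $V\to W$, then $|\mathbf{PD}^d(V)|\le|\mathbf{PD}^d(W)|$ for all $d$, and $\mathcal{X}_{i(V,W)}\colon\mathbf{PD}(V)\nrightarrow\mathbf{PD}(W)$ is the matching with domain $\mathbf{PD}(V)$ which, for each $d$, maps $\mathbf{PD}^d(V)$ in an order-preserving way onto the smallest $|\mathbf{PD}^d(V)|$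 points of $\mathbf{PD}^d(W)$. If there is an epimorphism $V\to W$, then $|\mathbf{PD}_b(W)|\le|\mathbf{PD}_b(V)|$ for all $b$, and $\mathcal{X}_{s(V,W)}\colon\mathbf{PD}(V)\nrightarrow\mathbf{PD}(W)$ is the matching with image $\mathbf{PD}(W)$ whose inverse, for each $b$, maps $\mathbf{PD}_b(W)$ in an order-preserving way onto the smallest $|\mathbf{PD}_b(W)|$ points of $\mathbf{PD}_b(V)$. For a morphism $\phi\colon V\to W$ of PFD modules, $\mathcal{X}_\phi$ is the composite matching obtained by first applying $\mathcal{X}_{s(V,\operatorname{im}\phi)}$ and then $\mathcal{X}_{i(\operatorname{im}\phi,W)}$. For $A,B\subseteq\mathbb{R}$: $A\lhd B$ (''$A$ bounds $B$ below'') means for all $y\in B$ there is $x\in A$ with $x\le y$; $A\blacktriangleleft B$ (''$B$ bounds $A$ above'') means for all $x\in A$ there is $y\in B$ with $x\le y$. An interval $\langle b,d\rangle$, and any point $[b,d,i]$, is $\sigma$-trivial if $\langle b,d\rangle\cap\sigma(\langle b,d\rangle)=\emptyset$, and $\sigma$-nontrivial otherwise. *)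

(* Defs.v *)
From HB Require Import structures.
From mathcomp Require Import all_boot all_order all_algebra.
From mathcomp Require Import all_classical all_reals.

Set Implicit Arguments.
Unset Strict Implicit.
Unset Printing Implicit Defensive.

Import Order.TTheory GRing.Theory Num.Theory.

Local Open Scope classical_set_scope.
Local Open Scope ring_scope.

(* Pointwise finite dimensional persistence modules: a [vectType K] is a
   finite dimensional vector space, and kernels, images and cokernels of
   morphisms of such modules are again of this kind. *)
Record pfd_module (R : realType) (K : fieldType) := PfdModule {
  pspace :> R -> vectType K;
  pmap : forall s t : R, s <= t -> 'Hom(pspace s, pspace t);
  pmap_id : forall (t : R) (tt : t <= t), pmap tt = \1%VF;
  pmap_comp : forall (r s t : R) (rs : r <= s) (st : s <= t) (rt : r <= t),
    (pmap st \o pmap rs)%VF = pmap rt }.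

Record pfd_hom (R : realType) (K : fieldType) (V W : pfd_module R K) :=
  PfdHom {
    hmap :> forall t : R, 'Hom(V t, W t);
    hmap_nat : forall (s t : R) (st : s <= t),
      (hmap t \o pmap V st)%VF = (pmap W st \o hmap s)%VF }.

Section Restriction.
Variables (K : fieldType).

Definition lfun_restr (A B : vectType K) (U : {vspace A}) (U' : {vspace B})
    (f : 'Hom(A, B)) : 'Hom(subvs_of U, subvs_of U') :=
  (linfun (vsproj U') \o f \o linfun vsval)%VF.

Lemma lfun_restrE (A B : vectType K) (U : {vspace A}) (U' : {vspace B})
    (f : 'Hom(A, B)) (u : subvs_of U) :
  (f @: U <= U')%VS -> vsval (lfun_restr U U' f u) = f (vsval u).
Proof.
move=> fU; rewrite /lfun_restr !comp_lfunE !lfunE /= vsprojK //.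
by apply: (subvP fU); apply: memv_img; apply: subvsP.
Qed.

(* The quotient of [A] by [U] is realized on the complement [U^C] chosen by
   the library; [quo_proj U] is the quotient map (see the two lemmas below). *)
Definition quo_proj (A : vectType K) (U : {vspace A}) :
    'Hom(A, subvs_of U^C) :=
  (linfun (vsproj U^C) \o daddv_pi U^C U)%VF.

Lemma quo_projE (A : vectType K) (U : {vspace A}) (v : A) :
  vsval (quo_proj U v) = daddv_pi U^C U v.
Proof. by rewrite /quo_proj comp_lfunE lfunE /= vsprojK // memv_pi. Qed.

Lemma quo_projD (A : vectType K) (U : {vspace A}) (v : A) :
  vsval (quo_proj U v) - v \in U.
Proof.
have cap : (U^C :&: U = 0)%VS by rewrite capvC capv_compl.
have vin : v \in (U^C + U)%VS by rewrite addvC addv_complf memvf.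
rewrite quo_projE -{2}(daddv_pi_add cap vin) opprD addNKr memvN.
exact: memv_pi.
Qed.

Lemma quo_proj_vsval (A : vectType K) (U : {vspace A}) (u : subvs_of U^C) :
  quo_proj U (vsval u) = u.
Proof.
apply: subvs_inj; rewrite quo_projE daddv_pi_id ?subvsP //.
by rewrite capvC capv_compl.
Qed.

Lemma lker_quo_proj (A : vectType K) (U : {vspace A}) :
  lker (quo_proj U) = U.
Proof.
apply/vspaceP => v; rewrite memv_ker; apply/eqP/idP => [v0|vU].
  by have := quo_projD U v; rewrite v0 linear0 sub0r memvN.
apply: subvs_inj; rewrite linear0; apply/eqP; rewrite -memv0.
rewrite -(capv_compl U) memv_cap subvsP andbT.
by rewrite -(subrK v (vsval _)) memvD // quo_projD.
Qed.

Lemma limg_quo_proj (A : vectType K) (U : {vspace A}) :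
  limg (quo_proj U) = fullv.
Proof.
apply/vspaceP => u; rewrite memvf -(quo_proj_vsval u); apply: memv_img.
exact: memvf.
Qed.

Definition lfun_quo (A B : vectType K) (U : {vspace A}) (U' : {vspace B})
    (f : 'Hom(A, B)) : 'Hom(subvs_of U^C, subvs_of U'^C) :=
  (quo_proj U' \o f \o linfun vsval)%VF.

Lemma lfun_quoE (A B : vectType K) (U : {vspace A}) (U' : {vspace B})
    (f : 'Hom(A, B)) (v : A) :
  (f @: U <= U')%VS -> lfun_quo U U' f (quo_proj U v) = quo_proj U' (f v).
Proof.
move=> fU; rewrite /lfun_quo 2!comp_lfunE [linfun vsval _]lfunE /=.
apply/eqP; rewrite -subr_eq0 -(linearB (quo_proj U')) -(linearB f).
rewrite -memv_ker lker_quo_proj.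
by apply: (subvP fU); apply: memv_img; apply: quo_projD.
Qed.

End Restriction.

Section SubQuotient.
Variables (R : realType) (K : fieldType) (V : pfd_module R K).
Variable U : forall t : R, {vspace V t}.

Definition pstable :=
  forall (s t : R) (st : s <= t), (pmap V st @: U s <= U t)%VS.

Hypothesis Ust : pstable.

Lemma sub_module_id (t : R) (tt : t <= t) :
  lfun_restr (U t) (U t) (pmap V tt) = \1%VF.
Proof.
apply/lfunP => u; apply: subvs_inj.
by rewrite lfun_restrE ?Ust // pmap_id !lfunE.
Qed.

Lemma sub_module_comp (r s t : R) (rs : r <= s) (st : s <= t) (rt : r <= t) :
  (lfun_restr (U s) (U t) (pmap V st) \o
   lfun_restr (U r) (U s) (pmap V rs))%VF =
  lfun_restr (U r) (U t) (pmap V rt).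
Proof.
apply/lfunP => u; apply: subvs_inj.
by rewrite comp_lfunE !lfun_restrE ?Ust // -comp_lfunE pmap_comp.
Qed.

Definition sub_module : pfd_module R K :=
  @PfdModule R K (fun t => subvs_of (U t) : vectType K)
    (fun s t st => lfun_restr (U s) (U t) (pmap V st))
    sub_module_id sub_module_comp.

Lemma quo_module_id (t : R) (tt : t <= t) :
  lfun_quo (U t) (U t) (pmap V tt) = \1%VF.
Proof.
apply/lfunP => u; rewrite -(quo_proj_vsval u) lfun_quoE ?Ust //.
by rewrite pmap_id !lfunE.
Qed.

Lemma quo_module_comp (r s t : R) (rs : r <= s) (st : s <= t) (rt : r <= t) :
  (lfun_quo (U s) (U t) (pmap V st) \o
   lfun_quo (U r) (U s) (pmap V rs))%VF =
  lfun_quo (U r) (U t) (pmap V rt).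
Proof.
apply/lfunP => u; rewrite -(quo_proj_vsval u) comp_lfunE.
by rewrite !lfun_quoE ?Ust // -[pmap V st _]comp_lfunE pmap_comp.
Qed.

Definition quo_module : pfd_module R K :=
  @PfdModule R K (fun t => subvs_of (U t)^C : vectType K)
    (fun s t st => lfun_quo (U s) (U t) (pmap V st))
    quo_module_id quo_module_comp.

End SubQuotient.

Section KerImCoker.
Variables (R : realType) (K : fieldType) (V W : pfd_module R K).
Variable phi : pfd_hom V W.

Lemma ker_stable : pstable (fun t => lker (phi t)).
Proof.
move=> s t st; apply/subvP => _ /memv_imgP[v vk ->].
move: vk; rewrite !memv_ker -comp_lfunE hmap_nat comp_lfunE => /eqP->.
by rewrite linear0.
Qed.

Lemma im_stable : pstable (fun t => limg (phi t)).
Proof.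
move=> s t st; apply/subvP => _ /memv_imgP[_ /memv_imgP[v _ ->] ->].
by rewrite -comp_lfunE -hmap_nat comp_lfunE memv_img ?memvf.
Qed.

Definition ker_module : pfd_module R K := sub_module ker_stable.
Definition im_module : pfd_module R K := sub_module im_stable.
Definition coker_module : pfd_module R K := quo_module im_stable.

End KerImCoker.

(* [sinfl] is the proof that the translation map [sigma] is inflationary. *)
Definition trivial_module (R : realType) (K : fieldType) (sigma : R -> R)
    (sinfl : forall x, x <= sigma x) (V : pfd_module R K) :=
  forall t : R, pmap V (sinfl t) = 0.

(* The totally ordered set of decorated points is [itv_bound R]: [t^-] is
   [BLeft t], [t^+] is [BRight t], and the infinite bounds are [-oo] and
   [+oo].  The interval represented by [(b, d)] is [Interval b d]. *)

Section IntervalModule.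
Variables (R : realType) (K : fieldType) (J : interval R).

(* The space at [t] is ['rV_1] if [t \in J] and ['rV_0] otherwise, and
   [pid_mx 1] is the identity between points of [J] and zero otherwise. *)
Definition itv_map (s t : R) : 'Hom('rV[K]_(s \in J), 'rV[K]_(t \in J)) :=
  linfun (mulmxr (pid_mx 1)).

Lemma itv_map_id (t : R) (tt : t <= t) : itv_map t t = \1%VF.
Proof.
apply/lfunP => v; rewrite !lfunE /=; case: (t \in J) v => v.
  by rewrite pid_mx_1 mulmx1.
by rewrite [v]thinmx0 mul0mx.
Qed.

Lemma itv_map_comp (r s t : R) (rs : r <= s) (st : s <= t) (rt : r <= t) :
  (itv_map s t \o itv_map r s)%VF = itv_map r t.
Proof.
apply/lfunP => v; rewrite comp_lfunE !lfunE /= -mulmxA.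
congr (v *m _).
have : r \in J -> t \in J -> s \in J.
  move=> rJ tJ; have /subitvP : (`[r, t] <= J)%O.
    by case: J rJ tJ => b d; rewrite !itv_boundlr => /andP[? _] /andP[_ ?];
       apply/andP.
  by apply; rewrite in_itv /= rs st.
clear v; case: (r \in J); case: (t \in J); case: (s \in J) => //= H.
- by rewrite !pid_mx_1 mulmx1.
- by have := H isT isT.
- by rewrite [LHS]thinmx0 [RHS]thinmx0.
- by rewrite [LHS]thinmx0 [RHS]thinmx0.
- by rewrite [LHS]flatmx0 [RHS]flatmx0.
- by rewrite [LHS]flatmx0 [RHS]flatmx0.
- by rewrite [LHS]flatmx0 [RHS]flatmx0.
- by rewrite [LHS]flatmx0 [RHS]flatmx0.
Qed.

Definition itv_module : pfd_module R K :=
  @PfdModule R K (fun t => 'rV[K]_(t \in J) : vectType K)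
    (fun s t _ => itv_map s t) itv_map_id itv_map_comp.

End IntervalModule.

(* The morphisms [iota i : U i -> V], [i \in D], exhibit [V] as a direct sum:
   at each [t], the induced map from the external direct sum of the spaces
   [U i t] to [V t] is surjective and injective. *)
Definition is_direct_sum (R : realType) (K : fieldType) (I : eqType)
    (D : set I) (U : I -> pfd_module R K) (V : pfd_module R K)
    (iota : forall i, pfd_hom (U i) V) :=
  forall t : R,
    (forall v : V t, exists (s : seq I) (x : forall i, U i t),
       [/\ uniq s, forall i, i \in s -> D i & v = \sum_(i <- s) iota i t (x i)])
    /\
    (forall (s : seq I) (x : forall i, U i t),
       uniq s -> (forall i, i \in s -> D i) ->
       \sum_(i <- s) iota i t (x i) = 0 -> forall i, i \in s -> x i = 0).

Section PersistenceDiagram.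
Variables (R : realType).

(* [(b, d, k)] is the point [[b, d, k]]. *)
Definition ppoint := (itv_bound R * itv_bound R * nat)%type.

Definition birth (p : ppoint) := p.1.1.
Definition death (p : ppoint) := p.1.2.
Definition pindex (p : ppoint) := p.2.
Definition pitv (p : ppoint) : interval R := Interval (birth p) (death p).

(* Copies of intervals are indexed from 1. *)
Definition points (m : interval R -> nat) : set ppoint :=
  [set p | (0 < pindex p <= m (pitv p))%N].

(* [m] is the multiplicity function of a decomposition of [V] into interval
   modules (of nonempty intervals). *)
Definition decomposition (K : fieldType) (V : pfd_module R K)
    (m : interval R -> nat) :=
  (forall J, (0 < m J)%N -> [set` J] !=set0) /\
  exists iota : forall p : ppoint, pfd_hom (itv_module K (pitv p)) V,
    is_direct_sum (points m) iota.

(* Such an [m] exists for every [V] (Crawley-Boevey) and is unique (Azumaya);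
   the default value of [xget] is therefore irrelevant. *)
Definition multiplicity (K : fieldType) (V : pfd_module R K) :
    interval R -> nat :=
  xget (fun=> 0%N) [set m | decomposition V m].

Definition PD (K : fieldType) (V : pfd_module R K) : set ppoint :=
  points (multiplicity V).

Definition PD_birth (K : fieldType) (V : pfd_module R K) (b : itv_bound R) :
    set ppoint :=
  [set p | PD V p /\ birth p = b].

Definition PD_death (K : fieldType) (V : pfd_module R K) (d : itv_bound R) :
    set ppoint :=
  [set p | PD V p /\ death p = d].

Definition left_lt (p q : ppoint) : bool :=
  (death q < death p)%O || (death p == death q) && (pindex p < pindex q)%N.

Definition right_lt (p q : ppoint) : bool :=
  (birth p < birth q)%O || (birth p == birth q) && (pindex p < pindex q)%N.

(* [f] maps [S] in an order-preserving way onto the smallest [|S|] points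
   of [T]. *)
Definition onto_smallest (lt : rel ppoint) (S T : set ppoint)
    (f : ppoint -> ppoint) :=
  [/\ forall p, S p -> T (f p),
      forall p q, S p -> S q -> lt p q -> lt (f p) (f q) &
      forall p q, S p -> T q -> lt q (f p) -> exists2 p', S p' & f p' = q].

Definition matching := set (ppoint * ppoint).

Definition dom (X : matching) : set ppoint := [set p | exists q, X (p, q)].
Definition im (X : matching) : set ppoint := [set q | exists p, X (p, q)].

(* First [X], then [Y]. *)
Definition comp_matching (X Y : matching) : matching :=
  [set pr | exists2 q, X (pr.1, q) & Y (q, pr.2)].

Variable K : fieldType.

Definition mono_matching (V W : pfd_module R K) : matching :=
  [set pq | PD V pq.1 /\
    exists2 f, onto_smallest right_lt (PD_death V (death pq.1))
                 (PD_death W (death pq.1)) f & f pq.1 = pq.2].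

Definition epi_matching (V W : pfd_module R K) : matching :=
  [set pq | PD W pq.2 /\
    exists2 f, onto_smallest left_lt (PD_birth W (birth pq.2))
                 (PD_birth V (birth pq.2)) f & f pq.2 = pq.1].

Definition induced_matching (V W : pfd_module R K) (phi : pfd_hom V W) :
    matching :=
  comp_matching (epi_matching V (im_module phi))
                (mono_matching (im_module phi) W).

End PersistenceDiagram.

Definition bounds_below (R : realType) (A B : set R) :=
  forall y, B y -> exists2 x, A x & x <= y.

Definition bounded_above_by (R : realType) (A B : set R) :=
  forall x, A x -> exists2 y, B y & x <= y.

Definition trivial_point (R : realType) (sigma : R -> R) (p : ppoint R) :=
  [set` pitv p] `&` (sigma @` [set` pitv p]) = set0.

(* Main.v *)
Require Import Defs.
From HB Require Import structures.
From mathcomp Require Import all_boot all_order all_algebra.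
From mathcomp Require Import all_classical all_reals.
From mathcomp Require normed_module.

Set Implicit Arguments.
Unset Strict Implicit.
Unset Printing Implicit Defensive.

Import Order.TTheory GRing.Theory Num.Theory.

Local Open Scope classical_set_scope.
Local Open Scope ring_scope.

(** The theorem rests on two ingredients: pointwise finite dimensional modules
    decompose into interval modules, and the points of a persistence diagram
    can be counted by conditions on vectors that behave well under morphisms.

    Decomposition (Crawley-Boevey). If [V t] is nonzero, an interval module
    that is nonzero at [t] splits off [V] ([exists_split_bar]). Generators and a
    retraction are obtained by a Mittag-Leffler argument ([section_down],
    [section_up]) from a vector of the smallest nonzero image in [V t] lying
    outside the largest kernel that does not contain this image. By Zorn's
    lemma there is a maximal family of split interval modules whose generators
    and retractions are orthogonal; its common complement has no split interval
    module, hence is zero ([exists_decomposition]).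

    Counting. For [y] before [d], the number of points with death [d] whose
    interval contains [y] is the largest [n] such that [V y] contains [n]
    vectors which die beyond [d] but remain independent in all degrees before
    [d] ([dying_vectorsP]). Dually, the points with birth [b] are counted by
    vectors that are independent modulo the images from degrees before [b]
    ([born_vectorsP]). Let [M] be the image of [phi]. Dying vectors of [M] are
    dying vectors of [W], and born vectors of [M] lift to [V]. If the cokernel
    is trivial, dying vectors of [W] at [y] are mapped to dying vectors of [M]
    at [sigma y]; if the kernel is trivial, born vectors of [V] at [sigma x]
    come from vectors whose images in [M] are born vectors at [x].

    Matchings. The points with a given death (or birth) are ordered like an
    initial segment of the natural numbers, since the interval of a point is
    contained in those of its predecessors. So an order-preserving map onto the
    smallest elements is a map preserving the number of predecessors
    ([onto_smallest_rank], [exists_onto_smallest]), and the inequalities between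
    counts bound the intervals of matched points ([death_rank_transfer],
    [birth_rank_transfer]). *)

(** * Choice, extremal elements and cofinal sequences *)

Lemma exists_argmin (I : Type) (P : set I) (F : I -> nat) (i0 : I) :
  P i0 -> exists2 i, P i & forall j, P j -> (F i <= F j)%N.
Proof.
move=> Pi0; have ex : exists n, `[< exists2 i, P i & F i = n >].
  by exists (F i0); apply/asboolP; exists i0.
case: (ex_minnP ex) => n /asboolP[i Pi <-] nmin; exists i => // j Pj.
by apply: nmin; apply/asboolP; exists j.
Qed.

Lemma dependent_choice (E : nat -> Type) (good : forall n, E n -> Prop)
    (rel : forall n, E n -> E n.+1 -> Prop) (x0 : E 0%N) :
  good 0%N x0 ->
  (forall n x, good n x -> exists2 y, good n.+1 y & rel n x y) ->
  exists x : forall n, E n,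
    x 0%N = x0 /\ forall n, good n (x n) /\ rel n (x n) (x n.+1).
Proof.
move=> g0 step.
have next n (u : {x : E n | good n x}) :
    {y : {y : E n.+1 | good n.+1 y} | rel n (sval u) (sval y)}.
  case: u => x gx; apply: cid; have [y gy rxy] := step n x gx.
  by exists (exist _ y gy).
pose z := fix z n : {x : E n | good n x} :=
  match n with
  | 0%N => exist _ x0 g0
  | m.+1 => sval (next m (z m))
  end.
exists (fun n => sval (z n)); split=> // n; split; first exact: svalP.
exact: svalP (next n (z n)).
Qed.

(** A set of reals containing [t] and lying above [t] is exhausted by a
    nondecreasing sequence starting at [t]: if the set has no maximum, one
    takes running maxima of elements lying above the successive rationals. *)
Lemma cofinal_sequence (R : realType) (A : set R) (t : R) :
  A t -> (forall u, A u -> t <= u) ->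
  exists s : nat -> R, [/\ s 0%N = t, forall n, A (s n),
    forall n, s n <= s n.+1 & forall u, A u -> exists n, u <= s n].
Proof.
move=> At tA; have [[m [Am mA]]|nomax] := pselect (exists m, A m /\
    forall u, A u -> u <= m).
  exists (fun n => if n is 0%N then t else m); split => //.
  - by case.
  - by case=> [|n] //; exact: tA.
  - by move=> u Au; exists 1%N; exact: mA.
have /choice[a aP] : forall n : nat, exists a, A a /\ forall u q, A u ->
    unpickle n = Some q -> ratr q < u -> ratr q < a.
  move=> n; case: (unpickle n) => [q|]; last by exists t.
  have [[u [Au qu]]|noq] := pselect (exists u, A u /\ ratr q < u).
    by exists u; split => // u' q' _ [<-].
  by exists t; split => // u q' Au [<-] qu; case: noq; exists u.
pose s := fix s n := match n with
  | 0%N => t | m.+1 => Num.max (s m) (a m) end.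
exists s; split => //.
- elim=> //= n IHn; rewrite /Num.max; case: ifP => _ //.
  exact: (aP n).1.
- by move=> n /=; rewrite le_max lexx.
- move=> u Au; have [v [Av uv]] : exists v, A v /\ u < v.
    apply: contrapT => nov; apply: nomax; exists u; split => // v Av.
    by rewrite leNgt; apply/negP => uv; apply: nov; exists v.
  have [q uq] := rat_in_itvoo uv.
  move: uq; rewrite in_itv /= => /andP[uq qv].
  exists (pickle q).+1 => /=; rewrite le_max; apply/orP; right.
  by apply/ltW/(lt_trans uq)/((aP (pickle q)).2 v) => //; rewrite pickleK.
Qed.

(** * Sections of persistence modules *)

Section Transition.
Variables (R : realType) (K : fieldType) (V : pfd_module R K).

(** The transition map of [V] from [s] to [t], made total by sending it to [0]
    when [t < s], so that no proof of [s <= t] has to be carried around. *)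
Definition tmap (s t : R) : 'Hom(V s, V t) :=
  match boolP (s <= t) with
  | AltTrue st => Defs.pmap V st
  | AltFalse _ => 0
  end.

Lemma tmapE (s t : R) (st : s <= t) : tmap s t = Defs.pmap V st.
Proof.
rewrite /tmap; case: {-}_ / (boolP (s <= t)) => [st'|/negP//].
by rewrite (bool_irrelevance st' st).
Qed.

Lemma tmap_id (t : R) (v : V t) : tmap t t v = v.
Proof. by rewrite (tmapE (lexx t)) Defs.pmap_id lfunE. Qed.

Lemma tmap_comp (r s t : R) (v : V r) :
  r <= s -> s <= t -> tmap s t (tmap r s v) = tmap r t v.
Proof.
move=> rs st; rewrite (tmapE rs) (tmapE st) (tmapE (le_trans rs st)).
by rewrite -comp_lfunE (Defs.pmap_comp V rs st (le_trans rs st)).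
Qed.

Lemma limg_tmap_le (r s t : R) :
  r <= s -> s <= t -> (limg (tmap r t) <= limg (tmap s t))%VS.
Proof.
move=> rs st; apply/subvP => _ /memv_imgP[w _ ->].
by rewrite -(tmap_comp w rs st) memv_img ?memvf.
Qed.

Lemma lker_tmap_le (s t u : R) :
  s <= t -> t <= u -> (lker (tmap s t) <= lker (tmap s u))%VS.
Proof.
move=> st tu; apply/subvP => w; rewrite !memv_ker => /eqP w0.
by rewrite -(tmap_comp w st tu) w0 linear0.
Qed.

(** The images in [V t] form a chain, ordered by their dimensions. *)
Lemma limg_tmap_dim (r s t : R) : r <= t -> s <= t ->
  (\dim (limg (tmap r t)) <= \dim (limg (tmap s t)))%N ->
  (limg (tmap r t) <= limg (tmap s t))%VS.
Proof.
move=> rt st; have [rs _|/ltW sr dle] := leP r s; first exact: limg_tmap_le.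
suff /eqP-> : limg (tmap s t) == limg (tmap r t) by [].
by rewrite eqEdim limg_tmap_le.
Qed.

(** The kernels in [V t] form a chain, ordered by the ranks of the maps. *)
Lemma lker_tmap_dim (t u w : R) : t <= u -> t <= w ->
  (\dim (limg (tmap t w)) <= \dim (limg (tmap t u)))%N ->
  (lker (tmap t u) <= lker (tmap t w))%VS.
Proof.
move=> tu tw; have [uw _|/ltW wu dle] := leP u w; first exact: lker_tmap_le.
suff /eqP-> : lker (tmap t w) == lker (tmap t u) by [].
rewrite eqEdim lker_tmap_le //=.
have := limg_ker_dim (tmap t u) fullv.
have := limg_ker_dim (tmap t w) fullv.
rewrite !capfv => <- e.
by rewrite -(leq_add2r (\dim (limg (tmap t u)))) e leq_add2l.
Qed.

(** Mittag-Leffler, downwards: a vector of [V t] that lifts to [V s] for every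
    [s] in [A] extends to a compatible family of lifts. A family is built
    along a sequence of [A] that is cofinal downwards, lifting at each step to
    a vector which still lifts to all of [A]; the images in a given space
    being finite dimensional, one of them is contained in all others. *)
Lemma section_down (t : R) (A : set R) (v : V t) :
  A t -> (forall s, A s -> s <= t) ->
  (forall s, A s -> exists z, tmap s t z = v) ->
  exists x : forall s, V s,
    x t = v /\ forall r s, A r -> A s -> r <= s -> tmap r s (x r) = x s.
Proof.
move=> At tA vim.
have [c [c0 cA cdec ccof]] : exists c : nat -> R, [/\ c 0%N = t,
    forall n, A (c n), forall n, c n.+1 <= c n
    & forall u, A u -> exists n, c n <= u].
  have [||s [s0 sA sinc scof]] := @cofinal_sequence R [set u | A (- u)] (- t).
  - by rewrite /= opprK.
  - by move=> u /= /tA ut; rewrite lerNl.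
  exists (fun n => - s n); split=> //; first by rewrite s0 opprK.
  - by move=> n; rewrite lerN2.
  - move=> u Au; have [|n un] := scof (- u); first by rewrite /= opprK.
    by exists n; rewrite lerNl.
(* [x] lifts to all of [A]; this property can be propagated downwards. *)
pose good s (x : V s) := forall r, A r -> r <= s -> exists z, tmap r s z = x.
have step s s' (x : V s) : A s' -> s' <= s -> good s x ->
    exists2 y : V s', good s' y & tmap s' s y = x.
  move=> As' ss' gx.
  (* The smallest image in [V s'] is that of [V r0]: what comes from [r0]
     comes from all of [A]. *)
  have [r0 [Ar0 r0s'] r0min] := @exists_argmin R [set r | A r /\ r <= s']
    (fun r => \dim (limg (tmap r s'))) s' (conj As' (lexx s')).
  have [z zx] := gx r0 Ar0 (le_trans r0s' ss').
  exists (tmap r0 s' z); last by rewrite tmap_comp.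
  move=> r Ar rs'; have : tmap r0 s' z \in limg (tmap r s').
    apply: (subvP (limg_tmap_dim r0s' rs' _)); first exact: r0min.
    by rewrite memv_img ?memvf.
  by case/memv_imgP => w _ ->; exists w.
have g0 : good (c 0%N) (tmap t (c 0%N) v).
  by rewrite c0 => r Ar rt; rewrite tmap_id; apply: vim.
have [x [x0 xP]] := dependent_choice (E := fun n => V (c n))
  (good := fun n => good (c n))
  (rel := fun n a b => tmap (c n.+1) (c n) b = a) g0
  (fun n x gx => step _ _ x (cA n.+1) (cdec n) gx).
have cmon m n : (m <= n)%N -> c n <= c m.
  move=> /subnK <-; elim: (n - m)%N => // k IH; rewrite addSn.
  exact: le_trans (cdec _) IH.
have xmon m n : (m <= n)%N -> tmap (c n) (c m) (x n) = x m.
  move=> /subnK <-; elim: (n - m)%N => [|k IH]; first by rewrite tmap_id.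
  by rewrite addSn -IH -(xP (k + m)%N).2 tmap_comp ?cmon ?leq_addl.
have ex s : exists z : V s, A s -> forall n, c n <= s -> tmap (c n) s (x n) = z.
  have [As|nAs] := pselect (A s); last by exists 0.
  have [n ns] := ccof s As; exists (tmap (c n) s (x n)) => _ m ms.
  have [mn|/ltnW nm] := leqP m n.
    by rewrite -(xmon m n mn) tmap_comp ?cmon.
  by rewrite -(xmon n m nm) tmap_comp ?cmon.
pose y s := sval (cid (ex s)).
have yP s : A s -> forall n, c n <= s -> tmap (c n) s (x n) = y s.
  exact: (svalP (cid (ex s))).
exists y; split.
  rewrite -(yP t At 0%N) ?c0 // x0.
  by rewrite tmap_comp ?tmap_id // c0.
move=> r s Ar As rs; have [n nr] := ccof r Ar.
by rewrite -(yP r Ar n nr) -(yP s As n (le_trans nr rs)) tmap_comp.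
Qed.

(** A linear form vanishing on the kernel of [h] factors through [h]. *)
Lemma form_factor (A B : vectType K) (h : 'Hom(A, B)) (f : 'Hom(A, K^o)) :
  (forall v, h v = 0 -> f v = 0) ->
  exists g : 'Hom(B, K^o), forall v, g (h v) = f v.
Proof.
move=> fk; exists (f \o h^-1)%VF => v; rewrite comp_lfunE /=.
apply/eqP; rewrite -subr_eq0 -linearB; apply/eqP/fk.
by rewrite linearB /= limg_lfunVK ?subrr ?memv_img ?memvf.
Qed.

(** Mittag-Leffler, upwards, for linear forms: a form on [V t] that factors
    through [V s] for every [s] in [A] extends to a compatible family of
    forms. *)
Lemma section_up (t : R) (A : set R) (f : 'Hom(V t, K^o)) :
  A t -> (forall s, A s -> t <= s) ->
  (forall s, A s -> forall v, tmap t s v = 0 -> f v = 0) ->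
  exists g : forall s, 'Hom(V s, K^o),
    g t = f /\ forall r s, A r -> A s -> r <= s ->
      forall v, g s (tmap r s v) = g r v.
Proof.
move=> At tA fker.
have [c [c0 cA cinc ccof]] := cofinal_sequence At tA.
(* [g] factors through all of [A]; this can be propagated upwards. *)
pose good s (g : 'Hom(V s, K^o)) := forall u, A u -> s <= u ->
  forall v, tmap s u v = 0 -> g v = 0.
have step s s' (g : 'Hom(V s, K^o)) : A s' -> s <= s' -> good s g ->
    exists2 h : 'Hom(V s', K^o), good s' h & forall v, h (tmap s s' v) = g v.
  move=> As' ss' gg.
  (* The largest kernel in [V s'] is that of the map to [V u0]: forms that
     factor through [u0] factor through all of [A]. *)
  have [u0 [Au0 u0s'] u0min] := @exists_argmin R [set u | A u /\ s' <= u]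
    (fun u => \dim (limg (tmap s' u))) s' (conj As' (lexx s')).
  have [h0 h0P] := form_factor (gg u0 Au0 (le_trans ss' u0s')).
  exists (h0 \o tmap s' u0)%VF; last by move=> v; rewrite comp_lfunE tmap_comp.
  move=> u Au s'u v v0; rewrite comp_lfunE.
  have := subvP (lker_tmap_dim s'u u0s' (u0min u (conj Au s'u))) v.
  by rewrite !memv_ker v0 eqxx => /(_ isT)/eqP->; rewrite linear0.
have g0 : good (c 0%N) (f \o tmap (c 0%N) t)%VF.
  by rewrite c0 => u Au tu v v0; rewrite comp_lfunE tmap_id; apply: (fker u).
have [x [x0 xP]] := dependent_choice (E := fun n => 'Hom(V (c n), K^o))
  (good := fun n => good (c n))
  (rel := fun n a b => forall v, b (tmap (c n) (c n.+1) v) = a v) g0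
  (fun n x gx => step _ _ x (cA n.+1) (cinc n) gx).
have cmon m n : (m <= n)%N -> c m <= c n.
  move=> /subnK <-; elim: (n - m)%N => // k IH; rewrite addSn.
  exact: le_trans IH (cinc _).
have xmon m n : (m <= n)%N -> forall v, x n (tmap (c m) (c n) v) = x m v.
  move=> /subnK <-; elim: (n - m)%N => [|k IH] v; first by rewrite tmap_id.
  by rewrite addSn -IH -(xP (k + m)%N).2 tmap_comp ?cmon ?leq_addl.
have ex s : exists g : 'Hom(V s, K^o), A s -> forall n, s <= c n ->
    forall v, x n (tmap s (c n) v) = g v.
  have [As|nAs] := pselect (A s); last by exists 0.
  have [n ns] := ccof s As; exists (x n \o tmap s (c n))%VF => _ m ms v.
  rewrite comp_lfunE; have [mn|/ltnW nm] := leqP m n.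
    by rewrite -(xmon m n mn) tmap_comp ?cmon.
  by rewrite -(xmon n m nm) tmap_comp ?cmon.
pose y s := sval (cid (ex s)).
have yP s : A s -> forall n, s <= c n -> forall v, x n (tmap s (c n) v) = y s v.
  exact: (svalP (cid (ex s))).
exists y; split.
  apply/lfunP => v; rewrite -(yP t At 0%N) ?c0 // x0 comp_lfunE.
  by rewrite tmap_comp ?tmap_id // c0.
move=> r s Ar As rs v; have [n ns] := ccof s As.
by rewrite -(yP r Ar n (le_trans rs ns)) -(yP s As n ns) tmap_comp.
Qed.

End Transition.

(** * Splitting off an interval module *)

Lemma lfun_of_linear (K : fieldType) (A B : vectType K) (f : A -> B) :
  linear f -> exists F : 'Hom(A, B), forall v, F v = f v.
Proof.
move=> lf; pose lin := GRing.isLinear.Build K A B *:%R f lf.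
pose g : {linear A -> B} := HB.pack f lin.
by exists (linfun g) => v; rewrite lfunE.
Qed.

Section LinearForms.
Variables (K : fieldType) (A : vectType K).

Lemma exists_form (w : A) : w != 0 -> exists f : 'Hom(A, K^o), f w = 1.
Proof.
move=> w0; have [i wi] : exists i, coord (vbasis fullv) i w != 0.
  apply/existsP; rewrite -negb_forall; apply: contraNN w0 => /forallP cw.
  rewrite (coord_vbasis (memvf w)) big1 // => i _.
  by rewrite (eqP (cw i)) scale0r.
exists ((coord (vbasis fullv) i w)^-1 *:
  linfun (coord (vbasis fullv) i : A -> K^o)).
by rewrite scale_lfunE lfunE /= [LHS]mulVf.
Qed.

(** Vectors [x i] that are separated by forms [f i] are independent, so that
    there are at most [\dim A] of them. *)
Lemma dual_family_dim (n : nat) (x : nat -> A) (f : nat -> 'Hom(A, K^o)) :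
  (forall i j, (i < n)%N -> (j < n)%N -> f i (x j) = (i == j)%:R) ->
  (n <= \dim {:A})%N.
Proof.
move=> fx; pose X := [tuple x i | i < n].
have fX : free X.
  apply/freeP => k k0 i; have /(congr1 (f i)) := k0.
  rewrite linear_sum linear0 (bigD1 i) //= big1 => [|j ji].
    rewrite linearZ /= nth_mktuple fx // eqxx addr0 => e.
    by rewrite -[LHS]mulr1.
  rewrite linearZ /= nth_mktuple fx // eq_sym (inj_eq val_inj) (negbTE ji).
  exact: mulr0.
by have := dimvS (subvf <<X>>%VS); rewrite (eqP fX) size_tuple.
Qed.

End LinearForms.

Section Bars.
Variables (R : realType) (K : fieldType).

(** An interval [bar_itv] together with a vector and a linear form in each
    degree. When [split_bar] holds, the vectors span a submodule isomorphic to
    the interval module of [bar_itv], and the forms give a retraction onto it: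
    it is a direct summand. *)
Record bar (V : pfd_module R K) := Bar {
  bar_itv : interval R;
  bar_vec : forall t : R, V t;
  bar_form : forall t : R, 'Hom(V t, K^o) }.

Definition split_bar (V : pfd_module R K) (e : bar V) :=
  [/\ [set` bar_itv e] !=set0,
      forall t, t \notin bar_itv e -> bar_vec e t = 0 /\ bar_form e t = 0,
      forall s t, s <= t -> s \in bar_itv e ->
        tmap V s t (bar_vec e s) = bar_vec e t,
      forall s t, s <= t -> t \in bar_itv e ->
        forall v, bar_form e t (tmap V s t v) = bar_form e s v &
      forall t, t \in bar_itv e -> bar_form e t (bar_vec e t) = 1].

(** Among the nonzero images in [V t] let [I] be the smallest one, and choose
    [v] in [I] outside the largest kernel of a map out of [V t] not containing
    [I]. The interval consists of the degrees whose image in [V t] is nonzero,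
    and those in which [I] survives; the vectors are lifts and images of [v],
    and the forms come from a form that is [1] on [v] and vanishes on that
    kernel. *)
Lemma exists_split_bar (V : pfd_module R K) (t : R) (v0 : V t) : v0 != 0 ->
  exists e : bar V, split_bar e /\ t \in bar_itv e.
Proof.
move=> v0N.
(* [Ab] and [Ad] are the parts of the interval below and above [t]. *)
pose Ab := [set s | s <= t /\ limg (tmap V s t) != 0%VS].
have Abt : Ab t.
  split => //; apply: contraNneq v0N => im0.
  by rewrite -memv0 -im0 -[v0](tmap_id (V := V)) memv_img ?memvf.
have [s0 [s0t Is0] s0min] :=
  @exists_argmin R Ab (fun s => \dim (limg (tmap V s t))) t Abt.
have sI s : Ab s -> (limg (tmap V s0 t) <= limg (tmap V s t))%VS.
  by move=> As; apply: limg_tmap_dim s0t As.1 (s0min s As).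
set I := limg (tmap V s0 t) in Is0 sI.
pose Ad := [set u | t <= u /\ ~~ (I <= lker (tmap V t u))%VS].
have Adt : Ad t.
  split => //; apply: contraNN Is0 => /subvP kI; rewrite -subv0; apply/subvP.
  by move=> w /kI; rewrite memv_ker tmap_id memv0.
have [u0 [tu0 Iu0] u0min] :=
  @exists_argmin R Ad (fun u => \dim (limg (tmap V t u))) t Adt.
have ku u : Ad u -> (lker (tmap V t u) <= lker (tmap V t u0))%VS.
  by move=> Au; apply: lker_tmap_dim Au.1 tu0 (u0min u Au).
have [v vI] := subvPn Iu0; rewrite memv_ker => vu0.
have [f0 f0v] := exists_form vu0.
pose f := (f0 \o tmap V t u0)%VF.
have fv : f v = 1 by rewrite comp_lfunE.
have [|s As|xs [xst xsc]] := @section_down _ _ V t Ab v Abt.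
- by move=> s [].
- by have /subvP/(_ _ vI)/memv_imgP[z _ ->] := sI s As; exists z.
have [|u Au w w0|g [gt gc]] := @section_up _ _ V t Ad f Adt.
- by move=> s [].
- have /subvP/(_ w) := ku u Au; rewrite !memv_ker w0 eqxx => /(_ isT)/eqP wu0.
  by rewrite comp_lfunE wu0 linear0.
(* Convexity of the interval, and vanishing outside of it. *)
have Abup s s' : Ab s -> s <= s' -> s' <= t -> Ab s'.
  move=> [st ns] ss' s't; split => //; apply: contraNneq ns => im0.
  by rewrite -subv0 -im0 limg_tmap_le.
have Addn u u' : Ad u -> t <= u' -> u' <= u -> Ad u'.
  move=> [tu nu] tu' u'u; split=> //; apply: contraNN nu => /subv_trans -> //.
  exact: lker_tmap_le.
have AbI s : s <= t -> ~ Ab s -> forall w, tmap V s t w = 0.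
  move=> st nAs w; apply/eqP; rewrite -memv0.
  have [<-|ne] := eqVneq (limg (tmap V s t)) 0%VS.
    by rewrite memv_img ?memvf.
  by case: nAs.
have AdI u : t <= u -> ~ Ad u -> tmap V t u v = 0.
  move=> tu nAu; have [|] := boolP (I <= lker (tmap V t u))%VS.
    by move=> /subvP/(_ v vI); rewrite memv_ker => /eqP.
  by move=> nI; case: nAu.
have Jitv : num_normedtype.is_interval (Ab `|` Ad).
  move=> x y Jx Jy z /andP[xz zy]; have [zt|/ltW tz] := leP z t.
    left; case: Jx => [Ax|[tx _]]; first exact: Abup xz zt.
    by have -> : z = t by apply/eqP; rewrite eq_le zt (le_trans tx xz).
  right; case: Jy => [[yt _]|Ay]; last exact: Addn Ay tz zy.
  by have -> : z = t by apply/eqP; rewrite eq_le tz (le_trans zy yt).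
pose J := normed_module.Rhull (Ab `|` Ad).
have JE s : (s \in J) <-> (Ab s \/ Ad s).
  have /normed_module.is_intervalP JJ := Jitv.
  by rewrite -[(Ab s \/ Ad s)]/((Ab `|` Ad) s) JJ.
(* The vectors and forms prolong those given by the two section lemmas, by
   mapping [v] upwards and by pulling [f] back downwards. *)
pose x s : V s := if pselect (Ab s) then xs s
                  else if pselect (Ad s) then tmap V t s v else 0.
pose h s : 'Hom(V s, K^o) := if pselect (Ad s) then g s
                  else if pselect (Ab s) then (f \o tmap V s t)%VF else 0.
have xb s : Ab s -> x s = xs s by rewrite /x; case: pselect.
have xu u : t <= u -> x u = tmap V t u v.
  move=> tu; rewrite /x; case: pselect => [Au|nAu].
    by rewrite -(xsc t u) ?xst.
  by case: pselect => // nAd; rewrite AdI.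
have hu u : Ad u -> h u = g u by rewrite /h; case: pselect.
have hb s : s <= t -> forall w, h s w = f (tmap V s t w).
  move=> st w; rewrite /h; case: pselect => [As|nAs].
    by rewrite -gt gc //; case: As.
  case: pselect => [As|nAb]; first by rewrite comp_lfunE.
  by rewrite AbI // linear0 lfunE.
exists (Bar J x h); split; last by apply/JE; left.
split => /=.
- by exists t; apply/JE; left.
- move=> s /negP sJ; have [nAb nAd] : ~ Ab s /\ ~ Ad s.
    by split => As; apply: sJ; apply/JE; [left|right].
  by rewrite /x /h; do 2 case: pselect => //.
- move=> r s rs /JE rJ; have [tr|/ltW rt] := leP t r.
    by rewrite (xu r tr) (xu s (le_trans tr rs)) tmap_comp.
  have Ar : Ab r.
    case: rJ => // -[tr _].
    by have -> : r = t by apply/eqP; rewrite eq_le rt tr.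
  rewrite (xb r Ar); have [st|/ltW ts] := leP s t.
    have As := Abup r s Ar rs st; by rewrite (xb s As) xsc.
  by rewrite (xu s ts) -(tmap_comp (V := V) (xs r) rt ts) xsc // xst.
- move=> r s rs /JE sJ w; have [st|/ltW ts] := leP s t.
    by rewrite !hb // ?tmap_comp // (le_trans rs st).
  have As : Ad s.
    case: sJ => // -[st _].
    by have -> : s = t by apply/eqP; rewrite eq_le ts st.
  rewrite (hu s As); have [tr|/ltW rt] := leP t r.
    have Ar := Addn s r As tr rs; by rewrite (hu r Ar) gc.
  by rewrite (hb r rt) -gt -(tmap_comp (V := V) w rt ts) gc.
- move=> s /JE[As|As].
    by rewrite (xb s As) hb ?xsc ?xst //; case: As.
  by rewrite (hu s As) xu ?gc ?gt //; case: As.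
Qed.

(** A set of split bars whose summands form a direct sum, with compatible
    projections. *)
Definition orthogonal_bars (V : pfd_module R K) (S : set (bar V)) :=
  (forall e, S e -> split_bar e) /\
  (forall e e', S e -> S e' -> e <> e' ->
     forall t, bar_form e t (bar_vec e' t) = 0).

Lemma orthogonal_bars_dim (V : pfd_module R K) (S : set (bar V)) (t : R)
    (n : nat) (h : nat -> bar V) : orthogonal_bars S ->
  (forall i j, (i < n)%N -> (j < n)%N -> h i = h j -> i = j) ->
  (forall i, (i < n)%N -> S (h i) /\ t \in bar_itv (h i)) ->
  (n <= \dim {:V t})%N.
Proof.
move=> [Ss So] hinj hS; apply: (@dual_family_dim K (V t) n
  (fun i => bar_vec (h i) t) (fun i => bar_form (h i) t)) => i j ilt jlt.
have [Si ti] := hS i ilt; have [Sj _] := hS j jlt.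
have [<-|/eqP ij] := eqVneq i j; first by have [_ _ _ _ ->] := Ss _ Si.
by rewrite So // => /hinj; apply: contra_not ij => ->.
Qed.

End Bars.

(** A set whose finite subfamilies have bounded size can be listed without
    repetition. *)
Lemma finite_listing (T : Type) (P : set T) (N : nat) (x0 : T) :
  (forall n (h : nat -> T),
     (forall i j, (i < n)%N -> (j < n)%N -> h i = h j -> i = j) ->
     (forall i, (i < n)%N -> P (h i)) -> (n <= N)%N) ->
  exists n (h : nat -> T),
    [/\ forall i j, (i < n)%N -> (j < n)%N -> h i = h j -> i = j,
        forall i, (i < n)%N -> P (h i) &
        forall x, P x -> exists2 i, (i < n)%N & h i = x].
Proof.
move=> bound; pose Q n := exists h : nat -> T,
  (forall i j, (i < n)%N -> (j < n)%N -> h i = h j -> i = j) /\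
  (forall i, (i < n)%N -> P (h i)).
have ex : exists n, `[< Q n >] by exists 0%N; apply/asboolP; exists (fun=> x0).
have ub n : `[< Q n >] -> (n <= N)%N by move=> /asboolP[h []]; exact: bound.
case: (ex_maxnP ex ub) => n /asboolP[h [hinj hP]] nmax.
exists n, h; split => // x Px; apply: contrapT => nx.
have hx i : (i < n)%N -> h i <> x by move=> ilt hi; apply: nx; exists i.
suff : (n.+1 <= n)%N by rewrite ltnn.
apply: nmax; apply/asboolP; exists (fun i => if i == n then x else h i).
have ltN k : (k < n.+1)%N -> k != n -> (k < n)%N.
  by move=> kn kN; rewrite ltn_neqAle kN.
split=> [i j ile jle|i ile]; last by case: eqVneq => // iN; exact/hP/ltN.
case: eqVneq => [->|iN]; case: eqVneq => [->|jN] //.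
- by move/esym => /hx; case; exact: ltN.
- by move/hx; case; exact: ltN.
- by apply: hinj; exact: ltN.
Qed.

(** * Decomposition into interval modules *)

Section Decomposition.
Variables (R : realType) (K : fieldType) (V : pfd_module R K).

Lemma exists_maximal_bars : exists S : set (bar V),
  orthogonal_bars S /\ forall B, S `<` B -> ~ orthogonal_bars B.
Proof.
apply: Zorn_bigcup => F FP Ftot.
split=> [e [S FS Se]|e e' [S FS Se] [S' FS' Se']].
  by have [Ss _] := FP S FS; apply: Ss.
have [SS'|S'S] := Ftot S S' FS FS'.
- by have [_ So] := FP S' FS'; apply: So => //; apply: SS'.
- by have [_ So] := FP S FS; apply: So => //; apply: S'S.
Qed.

Lemma finite_bars (S : set (bar V)) (t : R) : orthogonal_bars S ->
  exists n (h : nat -> bar V),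
    [/\ forall i j, (i < n)%N -> (j < n)%N -> h i = h j -> i = j,
        forall i, (i < n)%N -> S (h i) /\ t \in bar_itv (h i) &
        forall e, S e /\ t \in bar_itv e -> exists2 i, (i < n)%N & h i = e].
Proof.
move=> So; pose e0 : bar V := Bar `]-oo, +oo[ (fun=> 0) (fun=> 0).
apply: (@finite_listing _ [set e | S e /\ t \in bar_itv e] _ e0) => n h hinj hS.
exact: orthogonal_bars_dim So hinj hS.
Qed.

(** [Q] is the projection of [V t] onto the common kernel of the forms of the
    bars in [S], along their vectors. *)
Definition complement_projection (S : set (bar V)) (t : R)
    (Q : 'Hom(V t, V t)) :=
    [/\ forall e v, S e -> bar_form e t (Q v) = 0,
        forall v, (forall e, S e -> bar_form e t v = 0) -> Q v = v,
        forall e, S e -> Q (bar_vec e t) = 0 &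
        forall v, exists n (h : nat -> bar V) (a : nat -> K),
          [/\ forall i j, (i < n)%N -> (j < n)%N -> h i = h j -> i = j,
              forall i, (i < n)%N -> S (h i) /\ t \in bar_itv (h i) &
              v = Q v + \sum_(i < n) a i *: bar_vec (h i) t]].

Lemma exists_complement_projection (S : set (bar V)) (t : R) :
  orthogonal_bars S -> exists Q : 'Hom(V t, V t), complement_projection S Q.
Proof.
move=> So; have [n [h [hinj hS hsurj]]] := finite_bars t So.
pose q v := v - \sum_(i < n) (bar_form (h i) t v : K) *: bar_vec (h i) t.
have qlin : linear q.
  move=> a u v; rewrite /q scalerBr scaler_sumr addrACA -opprD -big_split /=.
  congr (_ - _); apply: eq_bigr => i _.
  by rewrite linearP scalerDl -scalerA.
have [Q QE] := lfun_of_linear qlin.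
have tJ e : S e -> t \notin bar_itv e -> bar_vec e t = 0 /\ bar_form e t = 0.
  by move=> Se; have [_ + _ _ _] := So.1 e Se; apply.
have one e : S e -> t \in bar_itv e -> bar_form e t (bar_vec e t) = 1.
  by move=> Se; have [_ _ _ _ +] := So.1 e Se; apply.
exists Q; split.
- move=> e v Se.
  have [te|/(tJ e Se)[_ ->]] := boolP (t \in bar_itv e); last first.
    by rewrite lfunE.
  have [i ilt hi] := hsurj e (conj Se te).
  rewrite QE /q linearB linear_sum (bigD1 (Ordinal ilt)) //= big1 => [|j ji].
    by rewrite linearZ /= hi one // addr0 [X in _ - X]mulr1 subrr.
  have [Sj _] := hS j (ltn_ord j).
  rewrite linearZ /= So.2 ?[LHS]mulr0 // -hi => /hinj e_ij.
  by move/eqP: ji; apply; apply: val_inj; rewrite /= -e_ij.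
- move=> v fv; rewrite QE /q big1 ?subr0 // => i _.
  by rewrite fv ?scale0r //; have [] := hS i (ltn_ord i).
- move=> e Se.
  have [te|/(tJ e Se)[-> _]] := boolP (t \in bar_itv e); last first.
    by rewrite linear0.
  have [i ilt hi] := hsurj e (conj Se te).
  rewrite QE /q (bigD1 (Ordinal ilt)) //= big1 => [|j ji].
    by rewrite hi one // scale1r addr0 subrr.
  have [Sj _] := hS j (ltn_ord j).
  rewrite So.2 ?scale0r // -hi => /hinj e_ij.
  by move/eqP: ji; apply; apply: val_inj; rewrite /= -e_ij.
- move=> v; exists n, h, (fun i => bar_form (h i) t v); split=> //.
  by rewrite QE subrK.
Qed.

(** The common kernel of the forms of a maximal orthogonal set is zero: it is
    a submodule, and a bar split off from it could be added to the set, its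
    forms being composed with the projection onto the common kernel. *)
Lemma maximal_bars_complete (S : set (bar V)) : orthogonal_bars S ->
  (forall B, S `<` B -> ~ orthogonal_bars B) ->
  forall t (v : V t), (forall e, S e -> bar_form e t v = 0) -> v = 0.
Proof.
move=> So Smax t v vk.
pose Q s := sval (cid (exists_complement_projection s So)).
have QP s : complement_projection S (Q s) by exact: svalP.
clearbody Q.
have Qf s e w : S e -> bar_form e s (Q s w) = 0 by have [+ _ _ _] := QP s; apply.
have Qid s w : (forall e, S e -> bar_form e s w = 0) -> Q s w = w.
  by have [_ + _ _] := QP s; apply.
have Qvec s e : S e -> Q s (bar_vec e s) = 0 by have [_ _ + _] := QP s; apply.
have Qdec s w := let: And4 _ _ _ H := QP s in H w.
pose U s := limg (Q s).
have UP s w : w \in U s <-> forall e, S e -> bar_form e s w = 0.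
  split=> [/memv_imgP[z _ ->] e Se|wk]; first exact: Qf.
  by rewrite -(Qid s w wk) memv_img ?memvf.
have fU s s' (w : V s) : s <= s' -> w \in U s -> tmap V s s' w \in U s'.
  move=> ss' /UP wk; apply/UP => e Se; have [_ out _ nat _] := So.1 e Se.
  have [s'e|/out[_ ->]] := boolP (s' \in bar_itv e); last by rewrite lfunE.
  by rewrite nat ?wk.
have Ust : pstable U.
  move=> s s' ss'; apply/subvP => _ /memv_imgP[w wU ->].
  by rewrite -(tmapE V) fU.
pose M := sub_module Ust.
have MvalE s s' (w : M s) : s <= s' ->
    vsval (tmap M s s' w : subvs_of (U s')) =
    tmap V s s' (vsval (w : subvs_of (U s))).
  by move=> ss'; rewrite !(tmapE _ ss') lfun_restrE // Ust.
(* The projections commute with the transition maps because both sides agree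
   on the common kernel and kill the vectors of the bars. *)
have Qnat s s' w : s <= s' -> Q s' (tmap V s s' w) = tmap V s s' (Q s w).
  move=> ss'; have [n [h [a [_ hS we]]]] := Qdec s w.
  rewrite {1}we !linearD; rewrite /= (Qid s' (tmap V s s' (Q s w))); last first.
    by apply/UP/fU => //; rewrite memv_img ?memvf.
  rewrite !linear_sum big1 ?addr0 // => i _; have [Si si] := hS i (ltn_ord i).
  have [_ _ vec _ _] := So.1 _ Si.
  by rewrite !linearZ /= vec // Qvec // scaler0.
apply: contrapT => /eqP vN0.
pose u : M t := vsproj (U t) v.
have uN0 : u != 0.
  apply: contra_neq vN0 => u0; rewrite -[v](@vsprojK _ _ (U t)) -/u; last exact/UP.
  by rewrite u0.
have [e [[[t0 t0e] eout evec eform eone] te]] := exists_split_bar uN0.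
pose p s : 'Hom(V s, subvs_of (U s)) := linfun (vsproj (U s)).
pose e' : bar V := Bar (bar_itv e)
  (fun s => vsval (bar_vec e s : subvs_of (U s)))
  (fun s => (bar_form e s \o (p s \o Q s))%VF).
have e'U s : bar_vec e' s \in U s by exact: subvsP.
have e'form s w : bar_form e' s w = bar_form e s (vsproj (U s) (Q s w)).
  by rewrite !comp_lfunE lfunE.
have e'one s : s \in bar_itv e -> bar_form e' s (bar_vec e' s) = 1.
  move=> se; rewrite e'form Qid; last exact/UP.
  by rewrite /= vsvalK eone.
have e'S : ~ S e'.
  move=> Se'; have /UP/(_ e' Se') := e'U t.
  by rewrite e'one // => /eqP; rewrite oner_eq0.
have e'split : split_bar e'.
  split => /=.
  - by exists t0.
  - move=> s /eout[-> ->]; split; first by rewrite linear0.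
    by apply/lfunP => w; rewrite !comp_lfunE !lfunE.
  - by move=> r s rs re; rewrite -MvalE // evec.
  - move=> r s rs se w; rewrite !comp_lfunE Qnat // -(eform r s rs se).
    congr (bar_form e s _); apply: subvs_inj; rewrite MvalE // !lfunE /=.
    by rewrite !vsprojK ?fU // memv_img ?memvf.
  - exact: e'one.
(* [e'] contradicts the maximality of [S]. *)
apply: (Smax (S `|` [set e'])).
  split; first by move=> ? ?; left.
  by move=> /(_ e' (or_intror erefl)).
split=> [e1 [Se1|->] //|e1 e2]; first exact: So.1.
move=> [Se1|->] [Se2|->] ne s //.
- exact: So.2.
- by have /UP := e'U s; apply.
- by rewrite e'form Qvec // linear0 linear0.
Qed.

(** Row vectors of length [0] or [1] are determined by the sum of their
    entries; this gives a coordinate on the spaces of an interval module. *)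
Lemma row_bool_eq0 (b : bool) (u : 'rV[K]_b) : \sum_j u 0 j = 0 -> u = 0.
Proof.
case: b u => u; last by rewrite [u]thinmx0.
by rewrite big_ord1 => u0; apply/rowP => j; rewrite ord1 u0 mxE.
Qed.

Lemma row_bool_sum (b : bool) (c : K) :
  b -> \sum_j (const_mx c : 'rV[K]_b) 0 j = c.
Proof. by case: b => // _; rewrite big_ord1 mxE. Qed.

(** Compatible vectors supported on [J] define a morphism from the interval
    module of [J]. *)
Lemma interval_hom (J : interval R) (x : forall t, V t) :
  (forall t, t \notin J -> x t = 0) ->
  (forall s t, s <= t -> s \in J -> tmap V s t (x s) = x t) ->
  exists f : pfd_hom (itv_module K J) V,
    forall t (u : itv_module K J t), f t u = (\sum_j u 0 j) *: x t.
Proof.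
move=> xout xc.
have ex t : exists F : 'Hom(itv_module K J t, V t),
    forall u, F u = (\sum_j u 0 j) *: x t.
  apply: lfun_of_linear => a u v; rewrite scalerA -scalerDl mulr_sumr -big_split.
  by congr (_ *: _); apply: eq_bigr => j _; rewrite !mxE.
pose F t := sval (cid (ex t)).
have FE t u : F t u = (\sum_j u 0 j) *: x t by exact: (svalP (cid (ex t))).
clearbody F.
have xnat s t : s <= t -> forall u : 'rV[K]_(s \in J),
    (\sum_j (u *m (pid_mx 1 : 'M_(s \in J, t \in J))) 0 j) *: x t =
    (\sum_j u 0 j) *: tmap V s t (x s).
  move=> st; move: (xout t) (xc s t st); case: (s \in J); case: (t \in J).
  - by move=> _ -> // u; rewrite pid_mx_1 mulmx1.
  - by move=> -> // -> // u; rewrite !scaler0.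
  - move=> _ _ u; rewrite [X in _ = X *: _]big_ord0 scale0r [u]thinmx0 mul0mx.
    by rewrite big1 ?scale0r // => j _; rewrite mxE.
  - by move=> -> // _ u; rewrite scaler0 big_ord0 scale0r.
have Fnat s t (st : s <= t) :
    (F t \o Defs.pmap (itv_module K J) st = Defs.pmap V st \o F s)%VF.
  apply/lfunP => u; rewrite !comp_lfunE !FE linearZ /= -(tmapE V) lfunE /=.
  exact: xnat.
by exists (PfdHom Fnat).
Qed.

(** Every pointwise finite dimensional module is a direct sum of interval
    modules, those of a maximal orthogonal set of bars. *)
Lemma exists_decomposition : exists m, decomposition V m.
Proof.
have [S [So Smax]] := exists_maximal_bars.
pose e0 : bar V := Bar `]-oo, +oo[ (fun=> 0) (fun=> 0).
(* The bars over a given interval are listed; [m] is the length of the list,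
   and the point [(b, d, k)] stands for the element of index [k - 1]. *)
have bars_over J : exists n (h : nat -> bar V),
    [/\ forall i j, (i < n)%N -> (j < n)%N -> h i = h j -> i = j,
        forall i, (i < n)%N -> S (h i) /\ bar_itv (h i) = J &
        forall e, S e /\ bar_itv e = J -> exists2 i, (i < n)%N & h i = e].
  have [[t tJ]|J0] := pselect ([set` J] !=set0).
    apply: (@finite_listing _ [set e | S e /\ bar_itv e = J] (\dim {:V t}) e0).
    move=> n h hinj hS; apply: orthogonal_bars_dim So hinj _ => i /hS[Si hi].
    by rewrite hi.
  apply: (@finite_listing _ [set e | S e /\ bar_itv e = J] 0 e0) => -[|n] // h _.
  move=> /(_ 0%N isT)[Sh hJ]; case: J0; rewrite -hJ.
  by have [] := So.1 _ Sh.
have [m {bars_over}mP] := choice bars_over.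
have [h hP] := choice mP; exists m; clear mP.
pose b (p : ppoint R) := h (pitv p) (pindex p).-1.
have pred_lt (p : ppoint R) : points m p -> ((pindex p).-1 < m (pitv p))%N.
  by case/andP; case: (pindex p).
have bS p : points m p -> S (b p) /\ bar_itv (b p) = pitv p.
  by move=> Dp; have [_ + _] := hP (pitv p); apply; exact: pred_lt.
have binj p q : points m p -> points m q -> b p = b q -> p = q.
  move=> Dp Dq bpq; have pq : pitv p = pitv q.
    by rewrite -(bS p Dp).2 bpq (bS q Dq).2.
  have [inj _ _] := hP (pitv p).
  have ipq : (pindex p).-1 = (pindex q).-1.
    apply: inj; [exact: pred_lt|by rewrite pq; exact: pred_lt|].
    by rewrite -[LHS]/(b p) bpq /b pq.
  case/andP: Dp => ip _; case/andP: Dq => iq _; clear bpq inj.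
  case: p q ip iq pq ipq => [[p1 p2] [|k]] [[q1 q2] [|l]] //= _ _.
  by rewrite /pitv /birth /death /pindex /= => -[-> ->] ->.
have bsurj e : S e -> exists p, points m p /\ b p = e.
  move=> Se; have [_ _ surj] := hP (bar_itv e).
  have [i ilt hi] := surj e (conj Se erefl).
  move: ilt hi; case: (bar_itv e) => d1 d2 ilt hi.
  by exists (d1, d2, i.+1); split.
split=> [J mJ|].
  have [_ hS _] := hP J; have [Sh <-] := hS 0%N mJ.
  by have [] := So.1 _ Sh.
have homs (p : ppoint R) : exists f : pfd_hom (itv_module K (pitv p)) V,
    points m p -> forall t u, f t u = (\sum_j u 0 j) *: bar_vec (b p) t.
  have [Dp|nDp] := pselect (points m p).
    have [Sb bp] := bS p Dp; have [_ out vec _ _] := So.1 _ Sb.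
    rewrite bp in out vec.
    have [f fE] := interval_hom (fun t tJ => (out t tJ).1) vec.
    by exists f.
  have [|s t _ _|f _] := @interval_hom (pitv p) (fun=> 0); last by exists f.
  - by [].
  - by rewrite linear0.
pose f p := sval (cid (homs p)).
have fE p : points m p ->
    forall t u, f p t u = (\sum_j u 0 j) *: bar_vec (b p) t.
  exact: (svalP (cid (homs p))).
clearbody f; exists f => t; split.
  move=> v; have [Q [Qf _ _ Qdec]] := exists_complement_projection t So.
  have [n [g [a [ginj gS ve]]]] := Qdec v.
  rewrite (maximal_bars_complete So Smax (fun e Se => Qf e v Se)) add0r in ve.
  have pex i : exists p : ppoint R, (i < n)%N -> points m p /\ b p = g i.
    case: (ltnP i n) => [/gS[Sg _]|_].
      by have [p pP] := bsurj _ Sg; exists p.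
    by exists (-oo, +oo, 0%N)%O.
  have [p pP] := choice pex.
  pose s := [seq p i | i <- index_iota 0 n].
  have sz : size s = n by rewrite size_map size_iota subn0.
  have nths i : (i < n)%N -> nth (p 0%N) s i = p i.
    by move=> ilt; rewrite (nth_map 0%N) ?size_iota ?subn0 // nth_iota ?subn0.
  have us : uniq s.
    rewrite map_inj_in_uniq ?iota_uniq // => i j.
    rewrite !mem_index_iota !leq0n /= => ilt jlt pij.
    by apply: ginj => //; rewrite -(pP i ilt).2 -(pP j jlt).2 pij.
  exists s, (fun q => const_mx (a (index q s))); split => //.
    by move=> q /mapP[i]; rewrite mem_index_iota => /andP[_ /pP[? _]] ->.
  rewrite ve /s big_map big_mkord; apply: eq_bigr => i _.
  have ilt := ltn_ord i; have [Dp bp] := pP i ilt; have [Sg tg] := gS i ilt.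
  rewrite fE // row_bool_sum; last by rewrite -(bS _ Dp).2 bp.
  by rewrite bp -/s -(nths i ilt) index_uniq ?sz.
move=> s x us sD sum0 q qs; have Dq := sD q qs; have [Sq bq] := bS q Dq.
have [tq|tq] := boolP (t \in pitv q); last first.
  apply: row_bool_eq0; apply: big1 => j _; move: j (x q) => /=.
  by rewrite (negbTE tq) => -[].
apply: row_bool_eq0; move/(congr1 (bar_form (b q) t)): sum0.
rewrite linear_sum linear0 (bigD1_seq q) //= big_seq_cond big1.
  have [_ _ _ _ one] := So.1 _ Sq.
  by rewrite fE // linearZ /= one ?bq // addr0 => e; rewrite -[LHS]mulr1.
move=> p /andP[/sD Dp pq]; have [Sp _] := bS p Dp.
rewrite fE // linearZ /= So.2 ?[LHS]mulr0 // => /(binj _ _ Dq Dp) qp.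
by rewrite qp eqxx in pq.
Qed.

End Decomposition.

(** * Counting the points of a persistence diagram *)

(** More vectors than coordinates satisfy a nontrivial linear relation; [r]
    indexes the coordinates. *)
Lemma exists_relation (K : fieldType) (I : eqType) (n : nat) (r : seq I)
    (a : nat -> I -> K) : (size r < n)%N ->
  exists c : nat -> K, (exists2 i, (i < n)%N & c i != 0) /\
    forall p, p \in r -> \sum_(i < n) c i * a i p = 0.
Proof.
move=> rn; pose A := \matrix_(i < n, j < size r) a i (tnth (in_tuple r) j).
have : kermx A != 0.
  rewrite kermx_eq0 /row_free; apply: contraTneq rn => <-.
  by rewrite -leqNgt rank_leq_col.
case/rowV0Pn => v /sub_kermxP vA v0.
have [i vi] : exists i, v 0 i != 0.
  apply/existsP; rewrite -negb_forall; apply: contraNN v0 => /forallP vi.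
  by apply/eqP/rowP => i; rewrite (eqP (vi i)) mxE.
pose c i := if insub i is Some j then v 0 j else 0.
have cv (k : 'I_n) : c k = v 0 k by rewrite /c valK.
exists c; split; first by exists i => //; rewrite cv.
move=> p /(tnthP (in_tuple r))[j ->]; have /rowP/(_ j) := vA.
rewrite !mxE => vA0; rewrite -[RHS]vA0; apply: eq_bigr => k _.
by rewrite cv !mxE.
Qed.

Lemma independent_dim (K : fieldType) (A : vectType K) (n : nat)
    (x : nat -> A) :
  (forall c : nat -> K, \sum_(i < n) c i *: x i = 0 ->
     forall i, (i < n)%N -> c i = 0) -> (n <= \dim {:A})%N.
Proof.
move=> xind; pose X := [tuple x i | i < n].
have fX : free X.
  apply/freeP => k k0 i.
  pose c j := if insub j is Some l then k l else 0.
  have ck (l : 'I_n) : c l = k l by rewrite /c valK.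
  rewrite -ck; apply: xind => //; rewrite -[RHS]k0.
  by apply: eq_bigr => l _; rewrite ck nth_mktuple.
by have := dimvS (subvf <<X>>%VS); rewrite (eqP fX) size_tuple.
Qed.

Section Bounds.
Variable R : realType.
Implicit Types (b d : itv_bound R) (y : R).

Lemma bound_between b d : (b < d)%O ->
  exists u : R, (b <= BLeft u)%O /\ (BRight u <= d)%O.
Proof.
case: b => [[] a|[]]; case: d => [[] c|[]] //; rewrite ?bnd_simp //.
- by move=> ac; exists a; rewrite !bnd_simp.
- by move=> ac; exists a; rewrite !bnd_simp.
- by move=> _; exists a; rewrite !bnd_simp.
- by move=> ac; exists ((a + c) / 2); rewrite !bnd_simp; split; rewrite midf_lt.
- by move=> ac; exists c; rewrite !bnd_simp.
- by move=> _; exists (a + 1); rewrite !bnd_simp ltrDl.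
- by move=> _; exists (c - 1); rewrite !bnd_simp ltrBlDr ltrDl.
- by move=> _; exists c; rewrite !bnd_simp.
- by move=> _; exists 0; rewrite !bnd_simp.
Qed.

(** Finitely many bounds less than [d] all lie below some real [u] before [d],
    which can be taken beyond a given one. *)
Lemma bound_above_seq (r : seq (itv_bound R)) d (u0 : R) :
  (BRight u0 <= d)%O -> (forall e, e \in r -> (e < d)%O) ->
  exists u, [/\ u0 <= u, (BRight u <= d)%O &
                forall e, e \in r -> (e <= BLeft u)%O].
Proof.
move=> u0d; elim: r => [|e r IH] rd; first by exists u0.
have [|u [u0u ud ru]] := IH; first by move=> e' e'r; rewrite rd // inE e'r orbT.
have [|w [ew wd]] := @bound_between e d; first by rewrite rd // mem_head.
exists (Num.max u w); split.
- by rewrite le_max u0u.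
- by rewrite /Num.max; case: ifP.
- move=> e'; rewrite inE => /predU1P[->|/ru e'u].
    by apply: le_trans ew _; rewrite bnd_simp le_max lexx orbT.
  by apply: le_trans e'u _; rewrite bnd_simp le_max lexx.
Qed.

(** The mirror image of [bound_above_seq]. *)
Lemma bound_below_seq (r : seq (itv_bound R)) b (u0 : R) :
  (b <= BLeft u0)%O -> (forall e, e \in r -> (b < e)%O) ->
  exists u, [/\ u <= u0, (b <= BLeft u)%O &
                forall e, e \in r -> (BRight u <= e)%O].
Proof.
move=> bu0; elim: r => [|e r IH] rb; first by exists u0.
have [|u [uu0 bu ru]] := IH; first by move=> e' e'r; rewrite rb // inE e'r orbT.
have [|w [bw we]] := @bound_between b e; first by rewrite rb // mem_head.
exists (Num.min u w); split.
- by rewrite ge_min uu0.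
- by rewrite /Num.min; case: ifP.
- move=> e'; rewrite inE => /predU1P[->|/ru ue'].
    by apply: le_trans we; rewrite bnd_simp ge_min lexx orbT.
  by apply: le_trans ue'; rewrite bnd_simp ge_min lexx.
Qed.

Lemma mem_pitv (p : ppoint R) y :
  (y \in pitv p) = (birth p <= BLeft y)%O && (BRight y <= death p)%O.
Proof. exact: itv_boundlr. Qed.

End Bounds.

Section BarcodeBasis.
Variables (R : realType) (K : fieldType) (V : pfd_module R K).

(** [x] is a basis of [V] adapted to the set [D] of points: in each degree [t]
    the vectors [x p t] of the points [p] whose interval contains [t] form a
    basis, and transition maps send [x p s] to [x p t], which is [0] outside
    the interval of [p]. *)
Definition barcode_basis (D : set (ppoint R))
    (x : ppoint R -> forall t, V t) :=
  [/\ forall p, D p -> [set` pitv p] !=set0,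
      forall p t, t \notin pitv p -> x p t = 0,
      forall p s t, s <= t -> s \in pitv p -> tmap V s t (x p s) = x p t,
      forall t (v : V t), exists (r : seq (ppoint R)) (a : ppoint R -> K),
        [/\ uniq r, forall p, p \in r -> D p /\ t \in pitv p &
            v = \sum_(p <- r) a p *: x p t] &
      forall t (r : seq (ppoint R)) (a : ppoint R -> K), uniq r ->
        (forall p, p \in r -> D p /\ t \in pitv p) ->
        \sum_(p <- r) a p *: x p t = 0 -> forall p, p \in r -> a p = 0].

Lemma row_boolE (b : bool) (u : 'rV[K]_b) : u = (\sum_j u 0 j) *: const_mx 1.
Proof.
case: b u => u; last by rewrite [LHS]thinmx0 [RHS]thinmx0.
by rewrite big_ord1; apply/rowP => j; rewrite ord1 !mxE mulr1.
Qed.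

Lemma decomposition_basis (m : interval R -> nat) :
  decomposition V m -> exists x, barcode_basis (points m) x.
Proof.
move=> [mne [f fsum]].
pose one (p : ppoint R) t : itv_module K (pitv p) t := const_mx 1.
have onE p t (u : itv_module K (pitv p) t) :
    f p t u = (\sum_j u 0 j) *: f p t (one p t).
  by rewrite -linearZ /= -[in RHS](row_boolE u).
have one0 p t : t \notin pitv p -> one p t = 0.
  rewrite /one /=; move: (t \in pitv p) => [] // _; exact: thinmx0.
exists (fun p t => f p t (one p t)); split.
- by move=> p /andP[p0 pm]; apply: mne; apply: leq_trans pm.
- by move=> p t /one0->; rewrite linear0.
- move=> p s t st sp; rewrite (tmapE V st) -comp_lfunE -hmap_nat comp_lfunE /=.
  congr (f p t _); rewrite lfunE /= /one.
  move: sp; case: (s \in pitv p) => // _; case: (t \in pitv p).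
    by rewrite pid_mx_1 mulmx1.
  by rewrite [LHS]thinmx0 [RHS]thinmx0.
- move=> t v; have [spn _] := fsum t; have [r [z [ur rD ve]]] := spn v.
  exists [seq p <- r | t \in pitv p], (fun p => \sum_j z p 0 j); split.
  + by rewrite filter_uniq.
  + by move=> p; rewrite mem_filter => /andP[tp /rD].
  + rewrite big_filter ve (bigID (fun p => t \in pitv p)) /= addrC big1 ?add0r.
      by apply: eq_bigr => p _; rewrite -onE.
    by move=> p tp; rewrite onE one0 // linear0 scaler0.
- move=> t r a ur rD sum0 p pr; have [_ ind] := fsum t.
  have := ind r (fun p => a p *: one p t) ur (fun p pr => (rD p pr).1) _ p pr.
  have -> : \sum_(i <- r) f i t (a i *: one i t) = 0.
    by rewrite -[RHS]sum0; apply: eq_bigr => i _; rewrite linearZ.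
  move=> /(_ erefl); have [_] := rD p pr; rewrite /one /=.
  by case: (t \in pitv p) => // _ /rowP/(_ 0); rewrite !mxE mulr1.
Qed.

Variables (D : set (ppoint R)) (x : ppoint R -> forall t, V t).
Hypothesis xb : barcode_basis D x.

(** By finite dimension, only finitely many intervals contain [t]. *)
Lemma points_at (t : R) : exists r : seq (ppoint R), uniq r /\
  forall p, p \in r <-> D p /\ t \in pitv p.
Proof.
have [_ _ _ _ ind] := xb.
have [|n [h [hinj hP hs]]] := @finite_listing (ppoint R)
    [set p | D p /\ t \in pitv p] (\dim {:V t}) (-oo, +oo, 0%N)%O.
  move=> n h hinj hP; apply: (@independent_dim K (V t) n (fun i => x (h i) t)).
  move=> c c0 i ilt; pose r := [seq h i | i <- index_iota 0 n].
  have sz : size r = n by rewrite size_map size_iota subn0.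
  have nthr j : (j < n)%N -> nth (h 0%N) r j = h j.
    by move=> jlt; rewrite (nth_map 0%N) ?size_iota ?subn0 // nth_iota ?subn0.
  have ur : uniq r.
    rewrite map_inj_in_uniq ?iota_uniq // => k l.
    by rewrite !mem_index_iota !leq0n /=; apply: hinj.
  have idx j : (j < n)%N -> index (h j) r = j.
    by move=> jlt; rewrite -(nthr j jlt) index_uniq ?sz.
  rewrite -(idx i ilt); apply: (ind t r (fun p => c (index p r))) => //.
  - by move=> p /mapP[j]; rewrite mem_index_iota => /andP[_ /hP +] ->.
  - rewrite -[RHS]c0 big_map big_mkord; apply: eq_bigr => j _.
    by rewrite -/r idx.
  - by apply/mapP; exists i; rewrite ?mem_index_iota.
exists [seq h i | i <- index_iota 0 n]; split.
  rewrite map_inj_in_uniq ?iota_uniq // => k l.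
  by rewrite !mem_index_iota !leq0n /=; apply: hinj.
move=> p; split=> [/mapP[j]|Dp].
  by rewrite mem_index_iota => /andP[_ /hP +] ->.
by have [i ilt <-] := hs p Dp; apply/mapP; exists i; rewrite ?mem_index_iota.
Qed.

End BarcodeBasis.

Lemma sum_seq_index (K : fieldType) (A : vectType K) (I : eqType) (p0 : I)
    (r : seq I) (c : nat -> K) (F : I -> A) : uniq r ->
  \sum_(i < size r) c i *: F (nth p0 r i) = \sum_(p <- r) c (index p r) *: F p.
Proof.
move=> ur; rewrite [RHS](big_nth p0) big_mkord.
by apply: eq_bigr => i _; rewrite index_uniq.
Qed.

(** [P] has at least [n] elements. *)
Definition at_least (T : eqType) (P : set T) (n : nat) :=
  exists r : seq T, [/\ uniq r, size r = n & forall p, p \in r -> P p].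

Section Counting.
Variables (R : realType) (K : fieldType) (V : pfd_module R K).

(** There are [n] vectors of [V y] that are killed by the maps to all degrees
    beyond [d], but whose images stay independent in all degrees before
    [d]. *)
Definition dying_vectors (d : itv_bound R) (y : R) (n : nat) :=
  exists v : nat -> V y,
    (forall u i, y <= u -> ~~ (BRight u <= d)%O -> (i < n)%N ->
       tmap V y u (v i) = 0) /\
    (forall u, y <= u -> (BRight u <= d)%O -> forall c : nat -> K,
       tmap V y u (\sum_(i < n) c i *: v i) = 0 ->
       forall i, (i < n)%N -> c i = 0).

(** The vector [v] of [V y] is zero or comes from a degree before [b]. *)
Definition older (b : itv_bound R) (y : R) (v : V y) :=
  v = 0 \/ exists w (z : V w),
    [/\ (BRight w <= b)%O, w <= y & v = tmap V w y z].

(** For every degree [u] between [b] and [y], there are [n] vectors of [V u]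
    whose images in [V y] are independent modulo the vectors coming from before
    [b]. Letting the vectors depend on [u] makes it possible to lift them along
    an epimorphism. *)
Definition born_vectors (b : itv_bound R) (y : R) (n : nat) :=
  forall u, (b <= BLeft u)%O -> u <= y ->
    exists v : nat -> V u, forall c : nat -> K,
      older b (tmap V u y (\sum_(i < n) c i *: v i)) ->
      forall i, (i < n)%N -> c i = 0.

Variables (D : set (ppoint R)) (x : ppoint R -> forall t, V t).
Hypothesis xb : barcode_basis D x.

Lemma basis_expand t (r : seq (ppoint R)) (v : V t) : uniq r ->
  (forall p, p \in r <-> D p /\ t \in pitv p) ->
  exists a : ppoint R -> K, v = \sum_(p <- r) a p *: x p t.
Proof.
move=> ur rP; have [_ _ _ spn _] := xb; have [s [a [us sD ->]]] := spn t v.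
exists (fun p => if p \in s then a p else 0).
rewrite [RHS](bigID (fun p => p \in s)) /= [X in _ = _ + X]big1 ?addr0; last first.
  by move=> p /negbTE ->; rewrite scale0r.
rewrite -[RHS]big_filter (perm_big [seq p <- r | p \in s]) /=; last first.
  apply: uniq_perm => //; first by rewrite filter_uniq.
  move=> p; rewrite mem_filter; apply/idP/andP => [ps|[]//].
  by split=> //; apply/rP/sD.
by rewrite !big_filter; apply: eq_bigr => p ->.
Qed.

(** Independence also holds for families of points whose intervals need not
    contain [t], as the vectors outside of the interval are [0]. *)
Lemma basis_free t (r : seq (ppoint R)) (a : ppoint R -> K) : uniq r ->
  (forall p, p \in r -> D p) -> \sum_(p <- r) a p *: x p t = 0 ->
  forall p, p \in r -> t \in pitv p -> a p = 0.
Proof.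
move=> ur rD sum0 p pr tp; have [_ out _ _ ind] := xb.
apply: (ind t [seq q <- r | t \in pitv q] a).
- by rewrite filter_uniq.
- by move=> q; rewrite mem_filter => /andP[tq /rD].
- rewrite big_filter -[RHS]sum0 [RHS](bigID (fun q => t \in pitv q)) /=.
  by rewrite [X in _ = _ + X]big1 ?addr0 // => q /out->; rewrite scaler0.
- by rewrite mem_filter tp.
Qed.

Lemma tmap_basis s t (r : seq (ppoint R)) (a : ppoint R -> K) : s <= t ->
  (forall p, p \in r -> s \in pitv p) ->
  tmap V s t (\sum_(p <- r) a p *: x p s) = \sum_(p <- r) a p *: x p t.
Proof.
move=> st rs; have [_ _ xc _ _] := xb; rewrite linear_sum big_seq_cond.
rewrite [RHS]big_seq_cond; apply: eq_bigr => p /andP[/rs sp _].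
by rewrite linearZ /= xc.
Qed.

Lemma basis_combination t (r : seq (ppoint R)) n (v : nat -> V t)
    (a : nat -> ppoint R -> K) (c : nat -> K) :
  (forall i, v i = \sum_(p <- r) a i p *: x p t) ->
  \sum_(i < n) c i *: v i = \sum_(p <- r) (\sum_(i < n) c i * a i p) *: x p t.
Proof.
move=> va; under eq_bigr do rewrite va scaler_sumr.
rewrite exchange_big /=; apply: eq_bigr => p _; rewrite scaler_suml.
by apply: eq_bigr => i _; rewrite scalerA.
Qed.

(** Given [n] points with death [d], their basis vectors at [y] are [n] dying
    vectors. Conversely, if there were fewer than [n] points, some nonzero
    combination of [n] dying vectors would have no component on these points.
    Mapping it beyond [d] shows that it has no component with a later death,
    and mapping it just before [d] kills the components with an earlier
    death. *)
Lemma dying_vectorsP (d : itv_bound R) (y : R) (n : nat) :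
  (BRight y <= d)%O -> dying_vectors d y n <->
  at_least [set p | [/\ D p, death p = d & y \in pitv p]] n.
Proof.
move=> yd; have [_ out xc _ _] := xb; split.
- move=> [v [vdie vlive]]; have [ry [ury ryP]] := points_at xb y.
  have [a va] := choice (fun i => basis_expand (v i) ury ryP).
  pose pts := [seq p <- ry | death p == d].
  have [npts|ptsn] := leqP n (size pts).
    exists (take n pts); split; first by rewrite take_uniq ?filter_uniq.
      by rewrite size_takel.
    move=> p /mem_take; rewrite mem_filter => /andP[/eqP pd /ryP[Dp yp]].
    by split.
  have [c [[i ilt ci] cr]] := exists_relation a ptsn.
  case/eqP: ci; pose e p := \sum_(i < n) c i * a i p.
  have ve : \sum_(i < n) c i *: v i = \sum_(p <- ry) e p *: x p y.
    exact: basis_combination va.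
  have ed p : p \in ry -> death p = d -> e p = 0.
    by move=> pry pd; apply: cr; rewrite mem_filter pd eqxx.
  have egt p : p \in ry -> (d < death p)%O -> e p = 0.
    move=> pry /bound_between[u [du up]].
    have yu : y < u by have := le_trans yd du; rewrite bnd_simp.
    have [Dp yp] := (ryP p).1 pry; move: yp; rewrite mem_pitv => /andP[py _].
    apply: (basis_free (t := u) ury) pry _ => [q /ryP[]//||].
      rewrite -(tmap_basis _ (ltW yu)) -?ve; last by move=> q /ryP[].
      rewrite linear_sum big1 // => j _; rewrite linearZ /= vdie ?scaler0 //.
        exact: ltW.
      by rewrite -ltNge; apply: le_lt_trans du _; rewrite bnd_simp.
    by rewrite mem_pitv up (le_trans py) // bnd_simp ltW.
  (* All intervals around [y] with an earlier death have ended at [u]. *)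
  have [|u [yu ud uP]] := @bound_above_seq R
      [seq death p | p <- ry & (death p < d)%O] d y yd.
    by move=> _ /mapP[p + ->]; rewrite mem_filter => /andP[].
  apply: (vlive u yu ud) ilt; rewrite ve tmap_basis //; last by move=> q /ryP[].
  apply: big1_seq => p /= pry; have [pd|dp|pd] := ltgtP (death p) d.
  + rewrite out ?scaler0 // mem_pitv negb_and; apply/orP; right.
    rewrite -ltNge; apply: le_lt_trans (uP (death p) _) _; last by rewrite bnd_simp.
    by apply/map_f; rewrite mem_filter pd.
  + by rewrite egt ?scale0r.
  + by rewrite ed ?scale0r.
- move=> [r [ur <- rP]].
  have rD p : p \in r -> D p by move=> /rP[].
  have ry p : p \in r -> y \in pitv p by move=> /rP[].
  pose p0 : ppoint R := (-oo, +oo, 0%N)%O.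
  exists (fun i => x (nth p0 r i) y); split.
    move=> u i yu ud ilt; have [_ pd yp] := rP _ (mem_nth p0 ilt).
    by rewrite xc // out // mem_pitv pd negb_and ud orbT.
  move=> u yu ud c; rewrite (sum_seq_index p0 c (fun p => x p y)) //.
  rewrite tmap_basis // => sum0 i ilt; rewrite -(index_uniq p0 ilt ur).
  apply: (basis_free ur rD sum0 (mem_nth p0 ilt)).
  have [_ pd] := rP _ (mem_nth p0 ilt); rewrite !mem_pitv pd => /andP[py _].
  by rewrite ud andbT (le_trans py) // bnd_simp.
Qed.

(** The dual count: at a degree [u] where no interval around [y] with a birth
    after [b] has begun, a combination of [n] vectors without components of
    birth [b] only has components of earlier birth at [y], so it comes from
    before [b]. *)
Lemma born_vectorsP (b : itv_bound R) (y : R) (n : nat) :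
  (b <= BLeft y)%O -> born_vectors b y n <->
  at_least [set p | [/\ D p, birth p = b & y \in pitv p]] n.
Proof.
move=> yb; have [_ out xc _ _] := xb; split.
- move=> born; have [ry [ury ryP]] := points_at xb y.
  pose pts := [seq p <- ry | birth p == b].
  have [npts|ptsn] := leqP n (size pts).
    exists (take n pts); split; first by rewrite take_uniq ?filter_uniq.
      by rewrite size_takel.
    move=> p /mem_take; rewrite mem_filter => /andP[/eqP pd /ryP[Dp yp]].
    by split.
  (* No interval around [y] with a later birth has begun at [u]. *)
  have [|u [uy bu uP]] := @bound_below_seq R
      [seq birth p | p <- ry & (b < birth p)%O] b y yb.
    by move=> _ /mapP[p + ->]; rewrite mem_filter => /andP[].
  have [v vfree] := born u bu uy; have [ru [uru ruP]] := points_at xb u.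
  have [a va] := choice (fun i => basis_expand (v i) uru ruP).
  have [c [[i ilt ci] cr]] := exists_relation a ptsn.
  case/eqP: ci; apply: vfree ilt.
  pose e p := \sum_(i < n) c i * a i p.
  rewrite (basis_combination _ _ va) tmap_basis //; last by move=> q /ruP[].
  (* The components at [y], all of birth less than [b]. *)
  pose old := [seq p <- ru | (y \in pitv p) && (birth p < b)%O].
  have -> : \sum_(p <- ru) e p *: x p y = \sum_(p <- old) e p *: x p y.
    rewrite big_filter [RHS]big_mkcond /=; apply: eq_big_seq => p /ruP[Dp up].
    case: ifPn => //; rewrite negb_and => /orP[yp|]; first by rewrite out ?scaler0.
    have [yp|yp _] := boolP (y \in pitv p); last by rewrite out ?scaler0.
    have pry : p \in ry by apply/ryP.
    have [//|bp _|bp _] := ltgtP (birth p) b.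
      have := uP (birth p) (map_f _ _); rewrite mem_filter bp => /(_ pry).
      move: up; rewrite mem_pitv => /andP[pu _] /le_trans/(_ pu).
      by rewrite bnd_simp ltxx.
    by rewrite [e p]cr ?scale0r // mem_filter bp eqxx.
  have [old0|[p0 p0old]] : old = [::] \/ exists p, p \in old.
    by case: old => [|p s]; [left|right; exists p; rewrite mem_head].
  + by left; rewrite old0 big_nil.
  + (* All intervals of [old] have begun at some degree before [b]. *)
    right; have [w0 [_ w0b]] : exists w0 : R, (birth p0 <= BLeft w0)%O /\
        (BRight w0 <= b)%O.
      by apply: bound_between; move: p0old; rewrite mem_filter => /andP[/andP[]].
    have [|w [_ wb wP]] := @bound_above_seq R [seq birth p | p <- old] b w0 w0b.
      by move=> _ /mapP[p + ->]; rewrite mem_filter => /andP[/andP[]].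
    have wy : w < y by have := le_trans wb yb; rewrite bnd_simp.
    exists w, (\sum_(p <- old) e p *: x p w); split; rewrite ?(ltW wy) //.
    rewrite tmap_basis ?(ltW wy) // => p pold.
    rewrite mem_pitv wP ?map_f //=.
    move: pold; rewrite mem_filter mem_pitv => /andP[/andP[/andP[_ yp] _] _].
    by apply: le_trans yp; rewrite bnd_simp ltW.
- move=> [r [ur <- rP]] u bu uy.
  have rD p : p \in r -> D p by move=> /rP[].
  have ry p : p \in r -> y \in pitv p by move=> /rP[].
  have ru p : p \in r -> u \in pitv p.
    move=> /rP[_ pb]; rewrite !mem_pitv pb bu /= => /andP[_ yp].
    by apply: le_trans yp; rewrite bnd_simp.
  pose p0 : ppoint R := (-oo, +oo, 0%N)%O.
  exists (fun i => x (nth p0 r i) u) => c.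
  rewrite (sum_seq_index p0 c (fun p => x p u)) // tmap_basis // => old i ilt.
  rewrite -(index_uniq p0 ilt ur); have ir := mem_nth p0 ilt.
  case: old => [sum0|[w [z [wb wy sumz]]]].
    by apply: (basis_free ur rD sum0 ir); apply: ry.
  have [rw [urw rwP]] := points_at xb w.
  have [a za] := basis_expand z urw rwP.
  have rrw p : p \in rw -> p \notin r.
    move=> /rwP[_]; rewrite mem_pitv => /andP[pw _]; apply/negP => /rP[_ pb _].
    have := le_trans wb (_ : b <= BLeft w)%O; rewrite -pb => /(_ pw).
    by rewrite bnd_simp ltxx.
  pose g p := if p \in r then c (index p r) else - a p.
  have gr p : p \in r -> g p = c (index p r) by rewrite /g => ->.
  rewrite -gr //; apply: (basis_free (t := y) (r := r ++ rw)).
  + rewrite cat_uniq ur urw andbT; apply/hasPn => p; exact: rrw.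
  + by move=> p; rewrite mem_cat => /orP[/rD|/rwP[]].
  + rewrite big_cat /= (eq_big_seq (fun p => c (index p r) *: x p y)); last first.
      by move=> p /gr->.
    rewrite sumz za tmap_basis //; last by move=> p /rwP[].
    rewrite [X in _ + X](eq_big_seq (fun p => - (a p *: x p y))).
      by rewrite sumrN subrr.
    by move=> p /rrw/negbTE; rewrite /g => ->; rewrite scaleNr.
  + by rewrite mem_cat ir.
  + exact: ry.
Qed.

End Counting.

(** * The effect of a morphism on the counts *)

Section Morphism.
Variables (R : realType) (K : fieldType) (V W : pfd_module R K).
Variable phi : pfd_hom V W.

Let M := im_module phi.

Lemma hmap_tmap s t (v : V s) :
  s <= t -> phi t (tmap V s t v) = tmap W s t (phi s v).
Proof. by move=> st; rewrite !(tmapE _ st) -!comp_lfunE hmap_nat. Qed.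

(** The two factors of [phi] through its image. *)
Definition im_incl t : 'Hom(M t, W t) :=
  linfun (vsval : subvs_of (limg (phi t)) -> W t).

Definition im_proj t : 'Hom(V t, M t) :=
  (linfun (vsproj (limg (phi t))) \o phi t)%VF.

Lemma im_incl_inj t : injective (im_incl t).
Proof. by move=> u v; rewrite !lfunE => /subvs_inj. Qed.

Lemma im_incl_proj t (v : V t) : im_incl t (im_proj t v) = phi t v.
Proof. by rewrite comp_lfunE !lfunE /= vsprojK // memv_img ?memvf. Qed.

Lemma im_proj_surj t (u : M t) : exists v, im_proj t v = u.
Proof.
have : im_incl t u \in limg (phi t) by rewrite lfunE; exact: subvsP.
case/memv_imgP => v _ uv; exists v; apply: im_incl_inj.
by rewrite im_incl_proj.
Qed.

Lemma im_incl_tmap s t (u : M s) :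
  s <= t -> im_incl t (tmap M s t u) = tmap W s t (im_incl s u).
Proof.
move=> st; rewrite !(tmapE _ st) [LHS]lfunE [im_incl s u]lfunE /=.
exact/lfun_restrE/im_stable.
Qed.

Lemma im_proj_tmap s t (v : V s) :
  s <= t -> im_proj t (tmap V s t v) = tmap M s t (im_proj s v).
Proof.
move=> st; apply: im_incl_inj.
by rewrite im_incl_tmap // !im_incl_proj hmap_tmap.
Qed.

Lemma dying_vectors_im (d : itv_bound R) y n :
  dying_vectors M d y n -> dying_vectors W d y n.
Proof.
move=> [v [vdie vlive]]; exists (fun i => im_incl y (v i)); split.
  by move=> u i yu ud ilt; rewrite -im_incl_tmap // vdie // linear0.
move=> u yu ud c sum0; apply: (vlive u yu ud).
apply: im_incl_inj; rewrite linear0 im_incl_tmap // -[RHS]sum0 linear_sum.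
by congr (tmap W y u _); apply: eq_bigr => i _; rewrite linearZ.
Qed.

Lemma born_vectors_im (b : itv_bound R) y n :
  born_vectors M b y n -> born_vectors V b y n.
Proof.
move=> born u bu uy; have [v vfree] := born u bu uy.
have [w wv] := choice (fun i => im_proj_surj (v i)).
exists w => c old; apply: vfree.
have -> : \sum_(i < n) c i *: v i = im_proj u (\sum_(i < n) c i *: w i).
  by rewrite linear_sum; apply: eq_bigr => i _; rewrite linearZ /= wv.
rewrite -im_proj_tmap //; case: old => [->|[s [z [sb sy ->]]]].
  by left; rewrite linear0.
by right; exists s, (im_proj s z); rewrite im_proj_tmap.
Qed.

Variables (sigma : R -> R) (sinfl : forall x, x <= sigma x).

Lemma coker_trivial_im t (w : W t) : trivial_module sinfl (coker_module phi) ->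
  exists u : M (sigma t), im_incl (sigma t) u = tmap W t (sigma t) w.
Proof.
move=> /(_ t) cok0.
have wim : tmap W t (sigma t) w \in limg (phi (sigma t)).
  rewrite -[limg _]lker_quo_proj memv_ker (tmapE _ (sinfl t)).
  rewrite -(lfun_quoE _ (im_stable phi (sinfl t))).
  rewrite -[lfun_quo _ _ _]/(Defs.pmap (coker_module phi) (sinfl t)).
  by rewrite cok0 lfunE.
by exists (vsproj _ (tmap W t (sigma t) w)); rewrite lfunE /= vsprojK.
Qed.

Lemma ker_trivial_tmap t (v : V t) : trivial_module sinfl (ker_module phi) ->
  im_proj t v = 0 -> tmap V t (sigma t) v = 0.
Proof.
move=> /(_ t) ker0 v0; have vk : v \in lker (phi t).
  by rewrite memv_ker -im_incl_proj v0 linear0.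
rewrite -(vsprojK vk) (tmapE _ (sinfl t)).
rewrite -(lfun_restrE _ (ker_stable phi (sinfl t))).
rewrite -[lfun_restr _ _ _]/(Defs.pmap (ker_module phi) (sinfl t)).
by rewrite ker0 lfunE.
Qed.

Lemma dying_vectors_coker (d : itv_bound R) y n :
  trivial_module sinfl (coker_module phi) ->
  dying_vectors W d y n -> dying_vectors M d (sigma y) n.
Proof.
move=> cok0 [v [vdie vlive]].
have [w wv] := choice (fun i => coker_trivial_im (v i) cok0).
exists w; split => [u i yu ud ilt|u yu ud c sum0].
  apply: im_incl_inj; rewrite im_incl_tmap // wv tmap_comp //.
  by rewrite vdie ?linear0 // (le_trans (sinfl y)).
apply: (vlive u (le_trans (sinfl y) yu) ud).
rewrite -(tmap_comp _ (sinfl y) yu) linear_sum.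
have -> : \sum_(i < n) tmap W y (sigma y) (c i *: v i) =
    im_incl (sigma y) (\sum_(i < n) c i *: w i).
  by rewrite linear_sum; apply: eq_bigr => i _; rewrite !linearZ /= wv.
by rewrite -im_incl_tmap // sum0 linear0.
Qed.

Lemma born_vectors_ker (b : itv_bound R) y n :
  trivial_module sinfl (ker_module phi) ->
  born_vectors V b (sigma y) n -> born_vectors M b y n.
Proof.
move=> ker0 born u bu uy.
have [v vfree] := born u bu (le_trans uy (sinfl y)).
exists (fun i => im_proj u (v i)) => c old; apply: vfree; move: old.
set g := \sum_(i < n) c i *: v i.
have -> : \sum_(i < n) c i *: im_proj u (v i) = im_proj u g.
  by rewrite linear_sum; apply: eq_bigr => i _; rewrite linearZ.
rewrite -(tmap_comp g uy (sinfl y)) -im_proj_tmap //.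
case=> [/(ker_trivial_tmap ker0)->|[s [z [sb sy]]]]; first by left.
have [w <-] := im_proj_surj z; rewrite -im_proj_tmap // => /eqP.
rewrite -subr_eq0 -linearB => /eqP/(ker_trivial_tmap ker0)/eqP.
rewrite linearB subr_eq0 /= => /eqP->; right; exists s, w.
by rewrite tmap_comp // (le_trans sy).
Qed.

End Morphism.

(** * Ranks and order-preserving matchings *)

Section Ranks.
Variables (R : realType) (lt : rel (ppoint R)).
Hypotheses (lt_irr : irreflexive lt) (lt_trans : transitive lt).

(** [S] is totally ordered by [lt], with finite initial segments: it has the
    order type of an initial segment of the natural numbers. *)
Definition omega_ordered (S : set (ppoint R)) :=
  (forall p q, S p -> S q -> [\/ p = q, lt p q | lt q p]) /\
  (forall p, S p -> exists r : seq (ppoint R),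
     uniq r /\ forall q, q \in r <-> S q /\ lt q p).

(** Exactly [n] elements of [S] lie below [p]. *)
Definition has_rank (S : set (ppoint R)) (p : ppoint R) (n : nat) :=
  exists r : seq (ppoint R),
    [/\ uniq r, size r = n & forall q, q \in r <-> S q /\ lt q p].

Lemma has_rank_fun S p m n : has_rank S p m -> has_rank S p n -> m = n.
Proof.
move=> [r [ur <- rP]] [s [us <- sP]]; apply/perm_size/uniq_perm => // q.
by apply/idP/idP => [/rP/sP|/sP/rP].
Qed.

Section OneSet.
Variable S : set (ppoint R).
Hypothesis So : omega_ordered S.

Lemma has_rank_ex p : S p -> exists n, has_rank S p n.
Proof. by move=> /(So.2)[r [ur rP]]; exists (size r), r. Qed.

Lemma has_rank_lt p q m n : S p ->
  lt p q -> has_rank S p m -> has_rank S q n -> (m < n)%N.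
Proof.
move=> Sp pq [r [ur <- rP]] [s [us <- sP]].
apply: (@uniq_leq_size _ (p :: r)) => [|p'].
  rewrite /= ur andbT; apply/negP => /rP[_]; by rewrite lt_irr.
rewrite inE => /predU1P[->|/rP[Sp' p'p]]; apply/sP; split=> //.
exact: lt_trans p'p pq.
Qed.

Lemma has_rank_inj p q n :
  S p -> S q -> has_rank S p n -> has_rank S q n -> p = q.
Proof.
move=> Sp Sq rp rq; case: (So.1 p q Sp Sq) => // [pq|qp].
- by have := has_rank_lt Sp pq rp rq; rewrite ltnn.
- by have := has_rank_lt Sq qp rq rp; rewrite ltnn.
Qed.

Lemma has_rank_choice : exists rk : ppoint R -> nat,
  (forall p, S p -> has_rank S p (rk p)) /\
  (forall p q, S p -> S q -> rk p = rk q -> p = q).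
Proof.
have ex p : exists n, S p -> has_rank S p n.
  have [/has_rank_ex[n pn]|nSp] := pselect (S p); first by exists n.
  by exists 0%N.
have [rk rkP] := choice ex; exists rk; split=> // p q Sp Sq pq.
by apply: (has_rank_inj Sp Sq (rkP p Sp)); rewrite pq; apply: rkP.
Qed.

(** By the pigeonhole principle, the ranks of the [n] predecessors of [q] are
    exactly the numbers less than [n]. *)
Lemma has_rank_below q m n : has_rank S q n -> (m < n)%N ->
  exists p, [/\ S p, lt p q & has_rank S p m].
Proof.
move=> rq mn; have [rk [rkP rkinj]] := has_rank_choice.
case: (rq) => r [ur rn rP]; have : uniq (map rk r).
  by rewrite map_inj_in_uniq // => p p' /rP[Sp _] /rP[Sp' _]; apply: rkinj.
move=> /uniq_min_size/(_ (_ : {subset _ <= iota 0 n})) min.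
have : m \in map rk r.
  have [||_ ->] := min; last by rewrite mem_iota add0n.
  - move=> _ /mapP[p /rP[Sp pq] ->]; rewrite mem_iota add0n.
    exact: has_rank_lt Sp pq (rkP p Sp) rq.
  - by rewrite size_iota size_map rn.
by case/mapP => p /rP[Sp pq] ->; exists p; split=> //; apply: rkP.
Qed.

(** Among more than [n] elements, one is at or above the element of rank
    [n]. *)
Lemma has_rank_seq (s : seq (ppoint R)) n :
  uniq s -> (forall p, p \in s -> S p) -> (n < size s)%N ->
  exists p, [/\ S p, has_rank S p n & exists2 q, q \in s & p = q \/ lt p q].
Proof.
move=> us sS ns; have [rk [rkP rkinj]] := has_rank_choice.
have [/hasP[q qs]|/hasPn small] := boolP (has (fun q => n <= rk q)%N s).
  rewrite leq_eqVlt => /predU1P[->|nq].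
    by exists q; split; [exact: sS|exact/rkP/sS|exists q => //; left].
  have [p [Sp pq pn]] := has_rank_below (rkP q (sS q qs)) nq.
  by exists p; split=> //; exists q => //; right.
have : uniq (map rk s).
  by rewrite map_inj_in_uniq // => p p' /sS Sp /sS Sp'; apply: rkinj.
move=> /(@uniq_leq_size _ _ (iota 0 n))/(_ _); rewrite size_map size_iota.
rewrite leqNgt ns => /(_ _)/negP; case=> // _ /mapP[q /small + ->].
by rewrite -ltnNge mem_iota add0n.
Qed.

Lemma has_rank_at_least p n : S p -> has_rank S p n ->
  exists r, [/\ uniq r, size r = n.+1 &
    forall q, q \in r -> S q /\ (q = p \/ lt q p)].
Proof.
move=> Sp [r [ur <- rP]]; exists (p :: r); split => //=.
  by rewrite ur andbT; apply/negP => /rP[_]; rewrite lt_irr.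
move=> q; rewrite inE => /predU1P[->|/rP[Sq qp]]; split=> //; first by left.
by right.
Qed.

End OneSet.

Variables S T : set (ppoint R).
Hypotheses (So : omega_ordered S) (To : omega_ordered T).

(** Order-preserving maps onto the smallest elements are the rank-preserving
    maps; they exist as soon as [T] has elements of all ranks occurring in
    [S]. *)
Lemma onto_smallest_rank f p n : onto_smallest lt S T f -> S p ->
  has_rank S p n -> has_rank T (f p) n.
Proof.
move=> [fT fmono fonto] Sp [r [ur <- rP]]; exists (map f r).
have finj q q' : S q -> S q' -> f q = f q' -> q = q'.
  move=> Sq Sq' ff; case: (So.1 q q' Sq Sq') => // [qq'|q'q].
  - by have := fmono _ _ Sq Sq' qq'; rewrite ff lt_irr.
  - by have := fmono _ _ Sq' Sq q'q; rewrite ff lt_irr.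
rewrite size_map; split => //.
  by rewrite map_inj_in_uniq // => q q' /rP[Sq _] /rP[Sq' _]; apply: finj.
move=> q; split=> [/mapP[q' /rP[Sq' q'p] ->]|[Tq qp]].
  by split; [exact: fT|exact: fmono].
have [q' Sq' q'q] := fonto p q Sp Tq qp; apply/mapP; exists q' => //.
apply/rP; split=> //; rewrite -q'q in qp.
case: (So.1 q' p Sq' Sp) => // [q'p|pq']; first by rewrite q'p lt_irr in qp.
by have := lt_trans qp (fmono _ _ Sp Sq' pq'); rewrite lt_irr.
Qed.

Lemma exists_onto_smallest :
  (forall p n, S p -> has_rank S p n -> exists2 q, T q & has_rank T q n) ->
  exists f, onto_smallest lt S T f.
Proof.
move=> ST; have ex p : exists q, S p -> forall n, has_rank S p n ->
    T q /\ has_rank T q n.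
  have [Sp|nSp] := pselect (S p); last by exists p.
  have [n pn] := has_rank_ex So Sp; have [q Tq qn] := ST p n Sp pn.
  by exists q => _ m pm; rewrite (has_rank_fun pm pn).
have [f fP] := choice ex; exists f; split.
- move=> p Sp; have [n pn] := has_rank_ex So Sp.
  by have [] := fP p Sp n pn.
- move=> p q Sp Sq pq; have [m pm] := has_rank_ex So Sp.
  have [n qn] := has_rank_ex So Sq.
  have [Tp fpm] := fP p Sp m pm; have [Tq fqn] := fP q Sq n qn.
  have mn := has_rank_lt Sp pq pm qn.
  case: (To.1 _ _ Tp Tq) => // [fpq|fqp].
    by rewrite fpq in fpm; rewrite (has_rank_fun fpm fqn) ltnn in mn.
  by have := ltn_trans mn (has_rank_lt Tq fqp fqn fpm); rewrite ltnn.
- move=> p q Sp Tq qfp; have [m pm] := has_rank_ex So Sp.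
  have [n qn] := has_rank_ex To Tq; have [_ fpm] := fP p Sp m pm.
  have nm := has_rank_lt Tq qfp qn fpm.
  have [p' [Sp' _ p'n]] := has_rank_below So pm nm; exists p' => //.
  have [Tp' fp'n] := fP p' Sp' n p'n.
  exact: has_rank_inj To _ _ _ Tp' Tq fp'n qn.
Qed.

End Ranks.

(** * Persistence diagrams and induced matchings *)

Section Diagrams.
Variables (R : realType) (K : fieldType).

Lemma right_lt_irr : irreflexive (@right_lt R).
Proof. by move=> p; rewrite /right_lt ltxx ltnn andbF. Qed.

Lemma left_lt_irr : irreflexive (@left_lt R).
Proof. by move=> p; rewrite /left_lt ltxx ltnn andbF. Qed.

Lemma right_lt_trans : transitive (@right_lt R).
Proof.
move=> q p r; rewrite /right_lt => /orP[pq|/andP[/eqP-> pq]].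
  case/orP => [qr|/andP[/eqP<- _]]; last by rewrite pq.
  by rewrite (lt_trans pq qr).
case/orP => [->//|/andP[/eqP-> qr]]; by rewrite eqxx (ltn_trans pq qr) orbT.
Qed.

Lemma left_lt_trans : transitive (@left_lt R).
Proof.
move=> q p r; rewrite /left_lt => /orP[pq|/andP[/eqP-> pq]].
  case/orP => [qr|/andP[/eqP<- _]]; last by rewrite pq.
  by rewrite (lt_trans qr pq).
case/orP => [->//|/andP[/eqP-> qr]]; by rewrite eqxx (ltn_trans pq qr) orbT.
Qed.

Lemma PD_basis (V : pfd_module R K) :
  exists x : ppoint R -> forall t, V t, barcode_basis (PD V) x.
Proof.
have [m dec] := exists_decomposition V.
exact: decomposition_basis (xgetPex (fun=> 0%N) (ex_intro _ m dec)).
Qed.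

Lemma PD_nonempty (V : pfd_module R K) p : PD V p -> exists y, y \in pitv p.
Proof. by have [x [ne _ _ _ _]] := PD_basis V; move=> /ne. Qed.

(** Among points with the same death (birth), smaller points have larger
    intervals. *)
Lemma right_lt_mem (p q : ppoint R) y :
  death q = death p -> p = q \/ right_lt p q -> y \in pitv q -> y \in pitv p.
Proof.
move=> qp pq; rewrite !mem_pitv qp => /andP[qy ->]; rewrite andbT.
apply: le_trans qy; case: pq => [->//|/orP[/ltW//|/andP[/eqP->]]//].
Qed.

Lemma left_lt_mem (p q : ppoint R) y :
  birth q = birth p -> p = q \/ left_lt p q -> y \in pitv q -> y \in pitv p.
Proof.
move=> qp pq; rewrite !mem_pitv qp => /andP[-> yq] /=.
apply: le_trans yq _; case: pq => [->//|/orP[/ltW//|/andP[/eqP->]]//].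
Qed.

Lemma ppoint_eq (p q : ppoint R) :
  birth p = birth q -> death p = death q -> pindex p = pindex q -> p = q.
Proof.
case: p q => [[b d] i] [[b' d'] i']; rewrite /birth /death /pindex /=.
by move=> -> -> ->.
Qed.

(** The initial segments of [PD_death V d] are finite because the interval of
    a point is contained in those of the smaller ones. *)
Lemma PD_death_ordered (V : pfd_module R K) d :
  omega_ordered (@right_lt R) (PD_death V d).
Proof.
split=> [p q [_ pd] [_ qd]|p [Dp pd]].
  rewrite /right_lt; case: ltgtP => [_|_|b]; [by apply: Or32|by apply: Or33|].
  case: ltngtP => i; rewrite ?orbT; [by apply: Or32|by apply: Or33|apply: Or31].
  by apply: ppoint_eq => //; rewrite pd.
have [x xb] := PD_basis V; have [y yp] := PD_nonempty Dp.
have [r [ur rP]] := points_at xb y.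
exists [seq q <- r | (death q == d) && right_lt q p].
split; first by rewrite filter_uniq.
move=> q; rewrite mem_filter; split=> [/andP[/andP[/eqP qd qp] /rP[Dq _]]|].
  by split.
move=> [[Dq qd] qp]; rewrite qd eqxx qp; apply/rP; split => //.
by apply: right_lt_mem yp; [rewrite pd|right].
Qed.

(** The same holds for [PD_birth V b]. *)
Lemma PD_birth_ordered (V : pfd_module R K) b :
  omega_ordered (@left_lt R) (PD_birth V b).
Proof.
split=> [p q [_ pb] [_ qb]|p [Dp pb]].
  rewrite /left_lt; case: ltgtP => [_|_|d]; [by apply: Or32|by apply: Or33|].
  case: ltngtP => i; rewrite ?orbT; [by apply: Or32|by apply: Or33|apply: Or31].
  by apply: ppoint_eq => //; rewrite pb.
have [x xb] := PD_basis V; have [y yp] := PD_nonempty Dp.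
have [r [ur rP]] := points_at xb y.
exists [seq q <- r | (birth q == b) && left_lt q p].
split; first by rewrite filter_uniq.
move=> q; rewrite mem_filter; split=> [/andP[/andP[/eqP qb qp] /rP[Dq _]]|].
  by split.
move=> [[Dq qb] qp]; rewrite qb eqxx qp; apply/rP; split => //.
by apply: left_lt_mem yp; [rewrite pb|right].
Qed.

(** If dying vectors of [V] at [y] yield as many dying vectors of [W] at [z],
    the point of [PD_death W d] with the same rank as a point around [y]
    exists, and its interval contains [z]. *)
Lemma death_rank_transfer (V W : pfd_module R K) (d : itv_bound R)
    (y z : R) p n :
  (forall k, dying_vectors V d y k -> dying_vectors W d z k) ->
  (BRight z <= d)%O ->
  PD_death V d p -> y \in pitv p -> has_rank (@right_lt R) (PD_death V d) p n ->
  exists q, [/\ PD_death W d q, has_rank (@right_lt R) (PD_death W d) q n &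
                z \in pitv q].
Proof.
move=> VW zd Dp yp pn; have [xV bV] := PD_basis V; have [xW bW] := PD_basis W.
have yd : (BRight y <= d)%O by case: Dp yp => _ <-; rewrite mem_pitv => /andP[].
have [r [ur rn rP]] := has_rank_at_least right_lt_irr Dp pn.
have : at_least [set q | [/\ PD V q, death q = d & y \in pitv q]] n.+1.
  exists r; split=> // q /rP[[Dq qd] qp]; split=> //.
  by apply: right_lt_mem yp => //; case: Dp => _ ->.
move=> /(dying_vectorsP bV _ yd)/VW/(dying_vectorsP bW _ zd)[s [us sn sP]].
have [||q [Dq qn [q0 /sP[_ q0d zq0] qq0]]] :=
  has_rank_seq right_lt_irr right_lt_trans (PD_death_ordered W d) (n := n) us.
- by move=> q /sP[].
- by rewrite sn.
- exists q; split=> //; apply: right_lt_mem qq0 zq0.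
  by case: Dq => _ ->.
Qed.

(** The analogue of [death_rank_transfer] for points with a given birth. *)
Lemma birth_rank_transfer (V W : pfd_module R K) (b : itv_bound R)
    (y z : R) p n :
  (forall k, born_vectors V b y k -> born_vectors W b z k) ->
  (b <= BLeft z)%O ->
  PD_birth V b p -> y \in pitv p -> has_rank (@left_lt R) (PD_birth V b) p n ->
  exists q, [/\ PD_birth W b q, has_rank (@left_lt R) (PD_birth W b) q n &
                z \in pitv q].
Proof.
move=> VW zb Dp yp pn; have [xV bV] := PD_basis V; have [xW bW] := PD_basis W.
have yb : (b <= BLeft y)%O by case: Dp yp => _ <-; rewrite mem_pitv => /andP[].
have [r [ur rn rP]] := has_rank_at_least left_lt_irr Dp pn.
have : at_least [set q | [/\ PD V q, birth q = b & y \in pitv q]] n.+1.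
  exists r; split=> // q /rP[[Dq qb] qp]; split=> //.
  by apply: left_lt_mem yp => //; case: Dp => _ ->.
move=> /(born_vectorsP bV _ yb)/VW/(born_vectorsP bW _ zb)[s [us sn sP]].
have [||q [Dq qn [q0 /sP[_ q0b zq0] qq0]]] :=
  has_rank_seq left_lt_irr left_lt_trans (PD_birth_ordered W b) (n := n) us.
- by move=> q /sP[].
- by rewrite sn.
- exists q; split=> //; apply: left_lt_mem qq0 zq0.
  by case: Dq => _ ->.
Qed.

Variables (V W : pfd_module R K) (phi : pfd_hom V W).
Let M := im_module phi.

(** Every point of the image is matched with the point of [W] with the same
    death and the same rank. *)
Lemma mono_matching_total p n : PD M p ->
  has_rank (@right_lt R) (PD_death M (death p)) p n ->
  exists q, [/\ PD_death W (death p) q,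
    has_rank (@right_lt R) (PD_death W (death p)) q n &
    mono_matching M W (p, q)].
Proof.
set d := death p => Dp pn.
have tr p' k : PD_death M d p' -> has_rank (@right_lt R) (PD_death M d) p' k ->
    exists2 q, PD_death W d q & has_rank (@right_lt R) (PD_death W d) q k.
  move=> Dp' pk; have [y yp] := PD_nonempty Dp'.1.
  have [//||q [Dq qk _]] := death_rank_transfer (W := W) (z := y) _ _ Dp' yp pk.
  - by move=> j; apply: dying_vectors_im.
  - by case: Dp' yp => _ <-; rewrite mem_pitv => /andP[].
  - by exists q.
have [f fS] := exists_onto_smallest right_lt_irr right_lt_trans
  (PD_death_ordered M d) (PD_death_ordered W d) tr.
have Dpd : PD_death M d p by [].
exists (f p); split; first by case: fS => /(_ p Dpd).
  exact: (onto_smallest_rank right_lt_irr right_lt_trans (PD_death_ordered M d)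
            fS Dpd).
by split=> //; exists f.
Qed.

Lemma mono_matching_points p q : mono_matching M W (p, q) ->
  PD M p /\ PD_death W (death p) q.
Proof.
by move=> [/= Dp [f fS <-]]; split => //; case: fS => /(_ p (conj Dp erefl)).
Qed.

Lemma mono_matching_rank p q n : mono_matching M W (p, q) ->
  has_rank (@right_lt R) (PD_death M (death p)) p n ->
  has_rank (@right_lt R) (PD_death W (death p)) q n.
Proof.
move=> [/= Dp [f fS <-]].
exact: (onto_smallest_rank right_lt_irr right_lt_trans (PD_death_ordered M _)
          fS (conj Dp erefl)).
Qed.

Lemma mono_matching_inj p p' q :
  mono_matching M W (p, q) -> mono_matching M W (p', q) -> p = p'.
Proof.
move=> pq p'q; have [Dp [_ qp]] := mono_matching_points pq.
have [Dp' [_ qp']] := mono_matching_points p'q.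
have Dpd : PD_death M (death q) p by [].
have Dpd' : PD_death M (death q) p' by [].
have [n pn] := has_rank_ex (PD_death_ordered M _) Dpd.
have [m p'm] := has_rank_ex (PD_death_ordered M _) Dpd'.
have qn := mono_matching_rank (n := n) pq; rewrite -qp in qn.
have qm := mono_matching_rank (n := m) p'q; rewrite -qp' in qm.
have mn := has_rank_fun (qm p'm) (qn pn); rewrite mn in p'm.
exact: (has_rank_inj right_lt_irr right_lt_trans (PD_death_ordered M _)
          Dpd Dpd' pn p'm).
Qed.

(** The inclusion of the image extends intervals to the left. *)
Lemma mono_matching_mem p q y :
  mono_matching M W (p, q) -> y \in pitv p -> y \in pitv q.
Proof.
move=> pq yp; have Dp : PD_death M (death p) p by case: pq.
have [n pn] := has_rank_ex (PD_death_ordered M (death p)) Dp.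
have [_ Dq] := mono_matching_points pq.
have qn := mono_matching_rank pq pn.
have [//||q' [Dq' q'n yq']] := death_rank_transfer (W := W) (z := y) _ _ Dp yp pn.
- by move=> j; apply: dying_vectors_im.
- by move: yp; rewrite mem_pitv => /andP[].
by rewrite (has_rank_inj right_lt_irr right_lt_trans (PD_death_ordered W _)
              Dq Dq' qn q'n).
Qed.

(** Every point of the image is matched with the point of [V] with the same
    birth and the same rank. *)
Lemma epi_matching_total p n : PD M p ->
  has_rank (@left_lt R) (PD_birth M (birth p)) p n ->
  exists q, [/\ PD_birth V (birth p) q,
    has_rank (@left_lt R) (PD_birth V (birth p)) q n &
    epi_matching V M (q, p)].
Proof.
set b := birth p => Dp pn.
have tr p' k : PD_birth M b p' -> has_rank (@left_lt R) (PD_birth M b) p' k ->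
    exists2 q, PD_birth V b q & has_rank (@left_lt R) (PD_birth V b) q k.
  move=> Dp' pk; have [y yp] := PD_nonempty Dp'.1.
  have [//||q [Dq qk _]] := birth_rank_transfer (W := V) (z := y) _ _ Dp' yp pk.
  - by move=> j; apply: born_vectors_im.
  - by case: Dp' yp => _ <-; rewrite mem_pitv => /andP[].
  - by exists q.
have [f fS] := exists_onto_smallest left_lt_irr left_lt_trans
  (PD_birth_ordered M b) (PD_birth_ordered V b) tr.
have Dpb : PD_birth M b p by [].
exists (f p); split; first by case: fS => /(_ p Dpb).
  exact: (onto_smallest_rank left_lt_irr left_lt_trans (PD_birth_ordered M b)
            fS Dpb).
by split=> //; exists f.
Qed.

Lemma epi_matching_points p q : epi_matching V M (q, p) ->
  PD M p /\ PD_birth V (birth p) q.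
Proof.
by move=> [/= Dp [f fS <-]]; split => //; case: fS => /(_ p (conj Dp erefl)).
Qed.

Lemma epi_matching_rank p q n : epi_matching V M (q, p) ->
  has_rank (@left_lt R) (PD_birth M (birth p)) p n ->
  has_rank (@left_lt R) (PD_birth V (birth p)) q n.
Proof.
move=> [/= Dp [f fS <-]].
exact: (onto_smallest_rank left_lt_irr left_lt_trans (PD_birth_ordered M _)
          fS (conj Dp erefl)).
Qed.

Lemma epi_matching_fun p p' q :
  epi_matching V M (q, p) -> epi_matching V M (q, p') -> p = p'.
Proof.
move=> pq p'q; have [Dp [_ qp]] := epi_matching_points pq.
have [Dp' [_ qp']] := epi_matching_points p'q.
have Dpd : PD_birth M (birth q) p by [].
have Dpd' : PD_birth M (birth q) p' by [].
have [n pn] := has_rank_ex (PD_birth_ordered M _) Dpd.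
have [m p'm] := has_rank_ex (PD_birth_ordered M _) Dpd'.
have qn := epi_matching_rank (n := n) pq; rewrite -qp in qn.
have qm := epi_matching_rank (n := m) p'q; rewrite -qp' in qm.
have mn := has_rank_fun (qm p'm) (qn pn); rewrite mn in p'm.
exact: (has_rank_inj left_lt_irr left_lt_trans (PD_birth_ordered M _)
          Dpd Dpd' pn p'm).
Qed.

(** The projection onto the image shortens intervals on the right. *)
Lemma epi_matching_mem p q y :
  epi_matching V M (q, p) -> y \in pitv p -> y \in pitv q.
Proof.
move=> pq yp; have Dp : PD_birth M (birth p) p by case: pq.
have [n pn] := has_rank_ex (PD_birth_ordered M (birth p)) Dp.
have [_ Dq] := epi_matching_points pq.
have qn := epi_matching_rank pq pn.
have [//||q' [Dq' q'n yq']] := birth_rank_transfer (W := V) (z := y) _ _ Dp yp pn.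
- by move=> j; apply: born_vectors_im.
- by move: yp; rewrite mem_pitv => /andP[].
by rewrite (has_rank_inj left_lt_irr left_lt_trans (PD_birth_ordered V _)
              Dq Dq' qn q'n).
Qed.

Variables (sigma : R -> R) (sinfl : forall x, x <= sigma x).

(** If the cokernel is trivial, every point of [PD W] whose interval contains
    [y], and whose death is beyond [sigma y], is matched with a point of the
    image whose interval contains [sigma y]. *)
Lemma coker_trivial_match q y : trivial_module sinfl (coker_module phi) ->
  PD W q -> y \in pitv q -> (BRight (sigma y) <= death q)%O ->
  exists2 p, mono_matching M W (p, q) & sigma y \in pitv p.
Proof.
move=> cok0 Dq yq yd; have Dqd : PD_death W (death q) q by [].
have [n qn] := has_rank_ex (PD_death_ordered W (death q)) Dqd.
have [p [[Dp pd] pn yp]] := death_rank_transfer (W := M) (z := sigma y)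
  (fun k => dying_vectors_coker cok0) yd Dqd yq qn.
exists p => //; rewrite -pd in pn.
have [q' [Dq' q'n pq']] := mono_matching_total Dp pn.
rewrite pd in Dq' q'n.
by rewrite (has_rank_inj right_lt_irr right_lt_trans (PD_death_ordered W _)
              Dqd Dq' qn q'n).
Qed.

(** If the kernel is trivial, every point of [PD V] whose interval contains
    [sigma x], and whose birth is before [x], is matched with a point of the
    image whose interval contains [x]. *)
Lemma ker_trivial_match p x : trivial_module sinfl (ker_module phi) ->
  PD V p -> sigma x \in pitv p -> (birth p <= BLeft x)%O ->
  exists2 q, epi_matching V M (p, q) & x \in pitv q.
Proof.
move=> ker0 Dp xp xb; have Dpb : PD_birth V (birth p) p by [].
have [n pn] := has_rank_ex (PD_birth_ordered V (birth p)) Dpb.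
have [q [[Dq qb] qn xq]] := birth_rank_transfer (W := M) (z := x)
  (fun k => born_vectors_ker ker0) xb Dpb xp pn.
exists q => //; rewrite -qb in qn.
have [p' [Dp' p'n p'q]] := epi_matching_total Dq qn.
rewrite qb in Dp' p'n.
by rewrite (has_rank_inj left_lt_irr left_lt_trans (PD_birth_ordered V _)
              Dpb Dp' pn p'n).
Qed.

End Diagrams.

Theorem theorem3p2 (R : realType) (K : fieldType) (V W : pfd_module R K)
    (phi : pfd_hom V W) (sigma : R -> R)
    (smono : {homo sigma : x y / x <= y})
    (sinfl : forall x : R, x <= sigma x) :
  (trivial_module sinfl (coker_module phi) ->
     (forall (b d : itv_bound R) (i : nat) (b' d' : itv_bound R) (i' : nat),
        induced_matching phi ((b, d, i), (b', d', i')) ->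
        bounds_below [set` Interval b d] (sigma @` [set` Interval b' d'])) /\
     (forall p : ppoint R,
        PD W p -> ~ trivial_point sigma p -> im (induced_matching phi) p)) /\
  (trivial_module sinfl (ker_module phi) ->
     (forall (b d : itv_bound R) (i : nat) (b' d' : itv_bound R) (i' : nat),
        induced_matching phi ((b, d, i), (b', d', i')) ->
        bounded_above_by (sigma @^-1` [set` Interval b d])
                         [set` Interval b' d']) /\
     (forall p : ppoint R,
        PD V p -> ~ trivial_point sigma p -> dom (induced_matching phi) p)).
Proof.
have nontrivial p : ~ trivial_point sigma p ->
    exists y, y \in pitv p /\ sigma y \in pitv p.
  move=> /eqP/set0P[z [/= sp [y yp ys]]].
  by exists y; rewrite ys.
split=> [cok0|ker0]; split.
- move=> b d i b' d' i' [q pq qw] _ [y /= yw <-].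
  have [Dq [Dw wd]] := mono_matching_points qw.
  have [sd|ds] := boolP (BRight (sigma y) <= d')%O.
    have [q' q'w] := coker_trivial_match cok0 Dw yw sd.
    rewrite (mono_matching_inj q'w qw) => sq.
    by exists (sigma y) => //=; apply: epi_matching_mem pq sq.
  (* [sigma y] is beyond [d'], hence above every element of [pitv q]. *)
  have [z zq] := PD_nonempty Dq.
  exists z; first exact: epi_matching_mem pq zq.
  rewrite leNgt; apply: contraNN ds => sz.
  move: zq; rewrite mem_pitv -wd => /andP[_]; apply: le_trans.
  by rewrite bnd_simp ltW.
- move=> w Dw /nontrivial[y [yw sw]].
  have [|q qw sq] := coker_trivial_match cok0 Dw yw.
    by move: sw; rewrite mem_pitv => /andP[].
  have Dq : PD_birth (im_module phi) (birth q) q by case: qw.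
  have [n qn] := has_rank_ex (PD_birth_ordered _ _) Dq.
  have [p [_ _ pq]] := epi_matching_total Dq.1 qn.
  by exists p, q.
- move=> b d i b' d' i' [q pq qw] x /= sx.
  have [Dq [Dp pb]] := epi_matching_points pq.
  have [bx|xb] := boolP (b <= BLeft x)%O.
    have [q' pq'] := ker_trivial_match ker0 Dp sx bx.
    rewrite (epi_matching_fun pq' pq) => xq.
    by exists x => //=; apply: mono_matching_mem qw xq.
  (* [x] is before [b], hence below every element of [pitv q]. *)
  have [z zq] := PD_nonempty Dq.
  exists z; first exact: mono_matching_mem qw zq.
  rewrite leNgt; apply: contraNN xb => zx.
  move: zq; rewrite mem_pitv -pb => /andP[bz _]; apply: le_trans bz _.
  by rewrite bnd_simp ltW.
- move=> p Dp /nontrivial[x [xp sp]].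
  have [|q pq xq] := ker_trivial_match ker0 Dp sp.
    by move: xp; rewrite mem_pitv => /andP[].
  have Dq : PD_death (im_module phi) (death q) q by case: pq.
  have [n qn] := has_rank_ex (PD_death_ordered _ _) Dq.
  have [w [_ _ qw]] := mono_matching_total Dq.1 qn.
  by exists w, q.
Qed.
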